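(* Suppose that the Jacobi operator $J$ is positive and let $J_F$ be its Friedrichs extension. Let $J_F^{-1}$ be compact. Let $\sigma(J_F)=\{\zeta_j:j\ge1\}$ be ordered so that $0<\zeta_1<\zeta_2<\cdots$, and for $n\ge1$ let $x_{1;n}<x_{2;n}<\cdots<x_{n;n}$ be the zeros of the $n$th monic orthogonal polynomial $p_n$. Then $$\zeta_j<x_{j;n},\qquad j=1,2,\ldots,n;\ n\ge1,$$ $$\zeta_j=\lim_{n\to\infty}x_{j;n},\qquad j=1,2,\ldots.$$
   Context: Let $(a_n)_{n\ge0}$ be positive numbers, $(b_n)_{n\ge0}$ real numbers. The Jacobi operator $J$ is the closure in $\ell^2(\mathbb{N}_0)$, $\mathbb{N}_0=\{0,1,2,\dots\}$, of the action on finitely supported sequences of the infinite symmetric tridiagonal matrix with diagonal entries $b_0,b_1,\dots$ and off-diagonal entries $a_0,a_1,\dots$. If $J$ is self-adjoint then $J_F=J$. The monic orthogonal polynomials are $p_0\equiv1$, $p_1(z)=z-b_0$, $zp_n(z)=a_{n-1}^2p_{n-1}(z)+b_np_n(z)+p_{n+1}(z)$, $n\ge1$. It is known that the zeros of $p_n$ are real, simple, and lie in $(\zeta_1,\infty)$, so $p_n(z)=(z-x_{1;n})\cdots(z-x_{n;n})$. *)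

(* Defs.v *)
From HB Require Import structures.
From mathcomp Require Import all_boot all_order all_algebra.
From mathcomp Require Import complex.
From mathcomp Require Import all_classical all_reals all_analysis.

Set Implicit Arguments.
Unset Strict Implicit.
Unset Printing Implicit Defensive.

Import Order.TTheory GRing.Theory Num.Theory.
Import numFieldNormedType.Exports.

Local Open Scope classical_set_scope.
Local Open Scope ring_scope.
Local Open Scope complex_scope.

(** * The complex Hilbert space l^2(N_0), as square-summable sequences *)

Section ell2.
Variable R : realType.
Implicit Types u v : nat -> R[i].

Definition ell2 u : Prop :=
  cvgn (series (fun n => Normc.normc (u n) ^+ 2)).

(* The sum of a complex series is taken componentwise; the inner product is
   linear in its first argument. Both are meaningful on [ell2] only. *)
Definition csum u : R[i] :=
  limn (series (fun n => complex.Re (u n))) +i*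
  limn (series (fun n => complex.Im (u n))).

Definition dot u v : R[i] := csum (fun n => u n * conjc (v n)).

Definition ell2_norm u : R :=
  Num.sqrt (limn (series (fun n => Normc.normc (u n) ^+ 2))).

Definition ell2_cvg (u_ : nat -> nat -> R[i]) u : Prop :=
  [/\ forall k, ell2 (u_ k), ell2 u &
      ell2_norm (u_ k \- u) @[k --> \oo] --> (0 : R)].

End ell2.

(** * Unbounded operators in l^2(N_0) *)

(* An operator is given by its graph: [T u v] means that u is in the domain of
   T and T u = v. *)
Definition operator (R : realType) := (nat -> R[i]) -> (nat -> R[i]) -> Prop.

Section operators.
Variable R : realType.
Implicit Types T B : operator R.

Definition op_closure T : operator R := fun u v =>
  exists u_ v_ : nat -> nat -> R[i],
    [/\ forall k, T (u_ k) (v_ k), ell2_cvg u_ u & ell2_cvg v_ v].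

Definition adjoint T : operator R := fun u v =>
  [/\ ell2 u, ell2 v & forall x y, T x y -> dot y u = dot x v].

(* In R[i], [0 <= z] means that z is real and nonnegative. *)
Definition positive_operator T : Prop :=
  forall u v, T u v -> 0 <= dot v u.

(* The restriction of T^* to the vectors of its domain that lie in the domain
   of the closure of the form u |-> <T u, u>, i.e. that are limits in l^2 of
   sequences of D(T) that are Cauchy for this form. *)
Definition friedrichs T : operator R := fun u v =>
  adjoint T u v /\
  exists u_ v_ : nat -> nat -> R[i],
    [/\ forall k, T (u_ k) (v_ k), ell2_cvg u_ u &
        forall e : R, 0 < e -> exists N : nat, forall k l : nat,
          (N <= k)%N -> (N <= l)%N ->
          complex.Re (dot (v_ k \- v_ l) (u_ k \- u_ l)) < e].

Definition op_inverse T : operator R := fun u v => T v u.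

Definition op_shift T (z : R[i]) : operator R := fun u w =>
  exists2 v, T u v & w = (fun n => v n - z * u n).

Definition everywhere_defined B : Prop :=
  forall u, ell2 u -> exists! v, B u v.

Definition bounded_operator B : Prop :=
  everywhere_defined B /\
  exists M : R, forall u v, B u v -> ell2_norm v <= M * ell2_norm u.

Definition compact_operator B : Prop :=
  everywhere_defined B /\
  forall (u_ v_ : nat -> nat -> R[i]) (M : R),
    (forall k, [/\ ell2 (u_ k), ell2_norm (u_ k) <= M & B (u_ k) (v_ k)]) ->
    exists (phi : nat -> nat) (v : nat -> R[i]),
      (forall k, (phi k < phi k.+1)%N) /\ ell2_cvg (v_ \o phi) v.

Definition resolvent_set T : set R[i] :=
  [set z | bounded_operator (op_inverse (op_shift T z))].

Definition spectrum T : set R[i] := ~` resolvent_set T.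

End operators.

(** * Jacobi operators and orthogonal polynomials *)

Section jacobi.
Variable R : realType.
Variables a b : nat -> R.

Definition jacobi_action (u : nat -> R[i]) (n : nat) : R[i] :=
  (if n is m.+1 then (a m)%:C * u m else 0)
  + (b n)%:C * u n + (a n)%:C * u n.+1.

Definition jacobi_finite : operator R := fun u v =>
  (exists N : nat, forall n : nat, (N <= n)%N -> u n = 0) /\
  v = jacobi_action u.

Definition jacobi : operator R := op_closure jacobi_finite.

Fixpoint ortho_poly (n : nat) : {poly R} :=
  if n is m.+1 then
    if m is k.+1 then
      ('X - (b m)%:P) * ortho_poly m - (a k ^+ 2) *: ortho_poly k
    else 'X - (b 0%N)%:P
  else 1.

End jacobi.

(* Main.v *)
(* With P_m = p_m / (a_0 ... a_{m-1}), the vectors (P_m(x_{i;n}))_{m < n} are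
   orthogonal eigenvectors of the n-th truncation of J, so every vector c
   supported in [0, n) satisfies
     |c|^2 = sum_i w_i Q_i^2  and  <Jc, c> = sum_i w_i x_{i;n} Q_i^2,
   where Q_i = sum_m c_m P_m(x_{i;n}) and 0 < w_i <= 1.  On the other side, an
   eigenvector of J_F for zeta is a multiple of (P_m(zeta))_m.

   Lower bound: if x_{j;n} <= zeta_j, choose c <> 0 in R^n orthogonal to the
   eigenvectors of zeta_1, ..., zeta_{j-1} and to those of the truncation for
   x_{j+1;n}, ..., x_{n;n}.  Then <Jc, c> <= x_{j;n} |c|^2 <= zeta_j |c|^2,
   while the variational characterization of zeta_j, obtained from the compact
   operator J_F^{-1}, gives the converse inequality with equality only for
   eigenvectors; but a finitely supported eigenvector vanishes.

   Convergence, by strong induction on j: finitely supported vectors u_m tend in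
   the form norm to an eigenvector for zeta_j.  Since x_{i;n} -> zeta_i for
   i < j, the components of u_m at x_{i;n}, i < j, are close to its inner
   products with the eigenvectors of zeta_i, which tend to 0, and the quadrature
   formula for <J u_m, u_m> bounds limsup x_{j;n} by zeta_j. *)

Require Import Defs.
From HB Require Import structures.
From mathcomp Require Import all_boot all_order all_algebra.
From mathcomp Require Import complex.
From mathcomp Require Import all_classical all_reals all_analysis.
From mathcomp Require Import ring lra zify.
Import Order.TTheory GRing.Theory Num.Theory.
Import numFieldNormedType.Exports.
Local Open Scope classical_set_scope.
Local Open Scope ring_scope.
Local Open Scope complex_scope.

Set Implicit Arguments.
Unset Strict Implicit.
Unset Printing Implicit Defensive.

(** * Jacobi recurrence and Gauss quadrature *)

Section jacobi_recurrence.
Context {R : realType} (a b : nat -> R).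
Hypothesis a_gt0 : forall n, 0 < a n.
Implicit Types (u v s : nat -> R) (z : R).

Definition jacobi_real u (n : nat) : R :=
  (if n is m.+1 then a m * u m else 0) + b n * u n + a n * u n.+1.

(** Dividing by the product of the [a k] makes the recurrence symmetric, so that at each [z] these
    values form a formal eigenvector of the Jacobi matrix. *)
Definition orthonormal_poly (n : nat) z : R :=
  (ortho_poly a b n).[z] / \prod_(k < n) a k.

(** Discrete Green identity: diagonal terms cancel and off-diagonal ones telescope, leaving only the
    coupling across the cut between [n.-1] and [n]. *)
Lemma jacobi_real_green u v n :
  \sum_(m < n) jacobi_real u m * v m - \sum_(m < n) u m * jacobi_real v m =
  if n is k.+1 then a k * (u k.+1 * v k - u k * v k.+1) else 0.
Proof.
elim: n => [|n IH]; first by rewrite !big_ord0 subrr.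
rewrite !big_ord_recr /= opprD addrACA IH /jacobi_real.
by case: n {IH} => [|n]; ring.
Qed.

(** The left sum has one more term: the image of a sequence supported below [n] can be nonzero at
    [n]. *)
Lemma jacobi_real_finite_sym u v n : (forall m, (n <= m)%N -> u m = 0) ->
  \sum_(m < n.+1) jacobi_real u m * v m = \sum_(m < n) u m * jacobi_real v m.
Proof.
move=> u0; apply/eqP; rewrite -subr_eq0.
have -> : \sum_(m < n) u m * jacobi_real v m =
          \sum_(m < n.+1) u m * jacobi_real v m.
  by rewrite big_ord_recr /= u0// mul0r addr0.
by rewrite jacobi_real_green u0// u0//; apply/eqP; ring.
Qed.

Lemma orthonormal_poly0 z : orthonormal_poly 0 z = 1.
Proof. by rewrite /orthonormal_poly /= hornerC big_ord0 divr1. Qed.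

Lemma jacobi_real_orthonormal_poly z n :
  jacobi_real (orthonormal_poly^~ z) n = z * orthonormal_poly n z.
Proof.
have pr_neq0 k : \prod_(i < k) a i != 0.
  by apply/prodf_neq0 => i _; rewrite gt_eqF.
have prS k : \prod_(i < k.+1) a i = \prod_(i < k) a i * a k.
  exact: big_ord_recr.
have a_neq0 k : a k != 0 by rewrite gt_eqF.
rewrite /jacobi_real /orthonormal_poly; case: n => [|n].
  rewrite prS big_ord0 /= hornerXsubC hornerC.
  by field.
rewrite !prS /= hornerD hornerN hornerZ hornerM hornerXsubC.
by field; rewrite pr_neq0 !a_neq0.
Qed.

(** As [a n] is nonzero, each row of the equation determines the next coordinate, so a solution is
    fixed by its value at 0. The induction carries two consecutive coordinates. *)
Lemma jacobi_real_eigenE z s : (forall n, jacobi_real s n = z * s n) ->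
  forall n, s n = s 0%N * orthonormal_poly n z.
Proof.
move=> sE n.
suff: s n = s 0%N * orthonormal_poly n z /\
      s n.+1 = s 0%N * orthonormal_poly n.+1 z by case.
have step u k : jacobi_real u k = z * u k ->
    u k.+1 = (z * u k - b k * u k - (if k is m.+1 then a m * u m else 0)) / a k.
  rewrite /jacobi_real => uE; have ak : a k != 0 by rewrite gt_eqF.
  rewrite -uE; set c := (X in _ - X); set d := (X in X + _ + _).
  by have -> : d = c by []; field.
elim: n => [|n [IH1 IH2]].
  split; first by rewrite orthonormal_poly0 mulr1.
  rewrite (step _ _ (sE 0%N)).
  rewrite (step _ _ (jacobi_real_orthonormal_poly z 0)) orthonormal_poly0.
  by ring.
split=> //; rewrite (step _ _ (sE n.+1)).
by rewrite (step _ _ (jacobi_real_orthonormal_poly z n.+1)) IH1 IH2; ring.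
Qed.

(** Row [N.+1] of the equation reduces to [a N * s N = 0], which lowers the support bound by one. *)
Lemma jacobi_real_finite_eigen z s N : (forall n, jacobi_real s n = z * s n) ->
  (forall n, (N <= n)%N -> s n = 0) -> forall n, s n = 0.
Proof.
move=> sE; elim: N => [s0 n|N IH s0]; first exact: s0.
apply: IH => n; rewrite leq_eqVlt => /predU1P[<-|]; last exact: s0.
have := sE N.+1; rewrite /jacobi_real (s0 N.+1)// (s0 N.+2)// !mulr0 !addr0 => /eqP.
by rewrite mulf_eq0 gt_eqF//= => /eqP.
Qed.

Section gauss_quadrature.
Variables (n : nat) (x : 'I_n -> R).
Hypothesis x_inj : injective x.
Hypothesis x_root : forall i, orthonormal_poly n (x i) = 0.

(** The Christoffel numbers of the quadrature with nodes [x i]. *)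
Definition gauss_weight (i : 'I_n) : R :=
  (\sum_(m < n) orthonormal_poly m (x i) ^+ 2)^-1.

Let sum_ge1 i : 1 <= \sum_(m < n) orthonormal_poly m (x i) ^+ 2.
Proof.
move: (leq_ltn_trans (leq0n i) (ltn_ord i)) (x i); case: (n) => // k _ y.
rewrite big_ord_recl /= orthonormal_poly0 expr1n lerDl.
by rewrite sumr_ge0// => m _; exact: sqr_ge0.
Qed.

Lemma gauss_weight_gt0 i : 0 < gauss_weight i.
Proof. by rewrite invr_gt0 (lt_le_trans ltr01). Qed.

Lemma gauss_weight_le1 i : gauss_weight i <= 1.
Proof. by rewrite invf_le1// (lt_le_trans ltr01). Qed.

(** By Green's identity, [x i - x j] times the sum is a boundary term, each product of which
    contains [P_n] at a node and vanishes. *)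
Let orth i j : i != j ->
  \sum_(m < n) orthonormal_poly m (x i) * orthonormal_poly m (x j) = 0.
Proof.
move=> ij.
have := jacobi_real_green (orthonormal_poly^~ (x i)) (orthonormal_poly^~ (x j)) n.
have -> : (if n is k.+1 then
  a k * (orthonormal_poly k.+1 (x i) * orthonormal_poly k (x j) -
         orthonormal_poly k (x i) * orthonormal_poly k.+1 (x j)) else 0) = 0.
  have := x_root i; have := x_root j.
  by case: (n) => // k -> ->; ring.
rewrite -sumrB.
under eq_bigr => m _ do
  rewrite !jacobi_real_orthonormal_poly -mulrA [X in _ - X]mulrCA -mulrBl.
rewrite -mulr_sumr => /eqP; rewrite mulf_eq0 subr_eq0 => /orP[|/eqP//].
by move/eqP/x_inj/eqP; rewrite (negPf ij).
Qed.

(** The rows of [T] are orthogonal, so [T^T W] is a right inverse of the square matrix [T], hence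
    also a left inverse; the latter relation is the Parseval identity. *)
Lemma gauss_parseval (c d : nat -> R) :
  \sum_(m < n) c m * d m = \sum_i gauss_weight i *
    (\sum_(m < n) c m * orthonormal_poly m (x i)) *
    (\sum_(m < n) d m * orthonormal_poly m (x i)).
Proof.
pose T : 'M[R]_n := \matrix_(i, m) orthonormal_poly m (x i).
pose W : 'M[R]_n := diag_mx (\row_i gauss_weight i).
have TW : T *m (T^T *m W) = 1%:M.
  apply/matrixP => i j; rewrite mulmxA mul_mx_diag !mxE.
  under eq_bigr do rewrite !mxE.
  have [<-|ij] := eqVneq i j; last by rewrite orth// mul0r.
  under eq_bigr do rewrite -expr2.
  by rewrite mulfV// gt_eqF// (lt_le_trans ltr01).
pose C : 'rV[R]_n := \row_m c m; pose D : 'rV[R]_n := \row_m d m.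
have := mulmx1C TW => WT.
have : (C *m D^T) 0 0 = (C *m T^T *m W *m (T *m D^T)) 0 0.
  by rewrite -!mulmxA (mulmxA W) (mulmxA T^T) (mulmxA T^T W) WT mul1mx.
rewrite [in LHS]mxE.
under eq_bigr do rewrite !mxE.
move=> ->; rewrite mul_mx_diag !mxE; apply: eq_bigr => i _; rewrite !mxE.
congr (_ * _); last by apply: eq_bigr => m _; rewrite !mxE mulrC.
by rewrite mulrC; congr (_ * _); apply: eq_bigr => m _; rewrite !mxE.
Qed.

Lemma gauss_energy (c : nat -> R) : (forall m, (n <= m)%N -> c m = 0) ->
  \sum_(m < n) jacobi_real c m * c m = \sum_i gauss_weight i * x i *
    (\sum_(m < n) c m * orthonormal_poly m (x i)) ^+ 2.
Proof.
move=> c0; rewrite gauss_parseval; apply: eq_bigr => i _.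
rewrite expr2 mulrA; congr (_ * _); rewrite -!mulrA; congr (_ * _).
(* Moving the Jacobi matrix onto the polynomials multiplies the transform by the node; the extra
   term at [n] vanishes because [x i] is a zero of [P_n]. *)
have := jacobi_real_finite_sym (orthonormal_poly^~ (x i)) c0.
rewrite big_ord_recr /= x_root mulr0 addr0 => ->.
by rewrite mulr_sumr; apply: eq_bigr => m _;
  rewrite jacobi_real_orthonormal_poly mulrCA.
Qed.

End gauss_quadrature.

Lemma root_orthonormal_poly n z : root (ortho_poly a b n) z ->
  orthonormal_poly n z = 0.
Proof. by rewrite /orthonormal_poly => /rootP ->; rewrite mul0r. Qed.

End jacobi_recurrence.

(** * Compact symmetric operators in a real Hilbert space *)

Lemma discriminant_le0 (R : realType) (A B C : R) : 0 <= C ->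
  (forall t, 0 <= A + 2 * t * B + t ^+ 2 * C) -> B ^+ 2 <= A * C.
Proof.
rewrite le_eqVlt => /predU1P[<-|C0] pos.
  have [->|B0] := eqVneq B 0; first by rewrite expr0n mulr0.
  (* With [C = 0] the expression is affine in [t]; this [t] gives it the value -1. *)
  have := pos (- (A + 1) / (2 * B)).
  have -> : A + 2 * (- (A + 1) / (2 * B)) * B + (- (A + 1) / (2 * B)) ^+ 2 * 0
    = -1 by field.
  by rewrite ler0N1.
(* The minimum of the quadratic is attained at [- B / C]. *)
have := pos (- B / C).
have -> : A + 2 * (- B / C) * B + (- B / C) ^+ 2 * C = (A * C - B ^+ 2) / C.
  by field; rewrite gt_eqF.
by rewrite pmulr_lge0 ?invr_gt0// subr_ge0.
Qed.

Lemma cvg_sqr_le0 (R : realType) (s t : nat -> R) :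
  (forall n, s n ^+ 2 <= t n) -> t n @[n --> \oo] --> (0 : R) ->
  s n @[n --> \oo] --> (0 : R).
Proof.
move=> st t0; apply/cvgr0Pnorm_lt => e e0.
have e20 : 0 < e ^+ 2 by rewrite exprn_gt0.
move/cvgr0Pnorm_lt : t0 => /(_ _ e20); apply: filterS => n tn.
rewrite -(@ltr_pXn2r _ 2)// ?nnegrE// ?normr_ge0 ?ltW// real_normK ?num_real//.
by rewrite (le_lt_trans (st n))// (le_lt_trans (ler_norm _)).
Qed.

Lemma cvg_eqr (R : realType) (s : nat -> R) (l l' : R) :
  s n @[n --> \oo] --> l -> l = l' -> s n @[n --> \oo] --> l'.
Proof. by move=> + <-. Qed.

Lemma cvg_mul0r (R : realType) (c : R) (s : nat -> R) :
  s n @[n --> \oo] --> (0 : R) -> c * s n @[n --> \oo] --> (0 : R).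
Proof. by move=> s0; apply: cvg_eqr (cvgMl_tmp s0) _; rewrite mulr0. Qed.

Lemma strict_incr_cvg (phi : nat -> nat) : (forall k, (phi k < phi k.+1)%N) ->
  phi n @[n --> \oo] --> \oo.
Proof.
move=> incr; have ge n : (n <= phi n)%N.
  by elim: n => // n IH; rewrite (leq_ltn_trans IH).
move=> A [N _ NA]; exists N => // n /= Nn; apply: NA => /=.
exact: leq_trans Nn (ge n).
Qed.

(** Completeness is left out here; it is a separate hypothesis made only for the Fredholm
    alternative. *)
Record inner_product (R : realType) (V : lmodType R) (ip : V -> V -> R) : Prop :=
  InnerProduct {
    inner_productC : forall u v, ip u v = ip v u;
    inner_productDl : forall u v w, ip (u + v) w = ip u w + ip v w;
    inner_productZl : forall c u v, ip (c *: u) v = c * ip u v;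
    inner_product_ge0 : forall u, 0 <= ip u u;
    inner_product_eq0 : forall u, ip u u = 0 -> u = 0 }.

Section real_hilbert.
Context {R : realType} {V : lmodType R} {ip : V -> V -> R}.
Hypothesis ipP : inner_product ip.
Let ipC := inner_productC ipP.
Let ipDl := inner_productDl ipP.
Let ipZl := inner_productZl ipP.
Let ip_ge0 := inner_product_ge0 ipP.
Let ip_eq0 := inner_product_eq0 ipP.
Implicit Types u v w f g h : V.

Lemma ipDr u v w : ip u (v + w) = ip u v + ip u w.
Proof. by rewrite ipC ipDl !(ipC u). Qed.

Lemma ipZr c u v : ip u (c *: v) = c * ip u v.
Proof. by rewrite ipC ipZl (ipC u). Qed.

Lemma ipNl u v : ip (- u) v = - ip u v.
Proof. by rewrite -scaleN1r ipZl mulN1r. Qed.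

Lemma ipNr u v : ip u (- v) = - ip u v.
Proof. by rewrite ipC ipNl ipC. Qed.

Lemma ip0l u : ip 0 u = 0.
Proof. by rewrite -(scale0r u) ipZl mul0r. Qed.

Lemma ip0r u : ip u 0 = 0.
Proof. by rewrite ipC ip0l. Qed.

Definition ipE := (ipDl, ipDr, ipNl, ipNr, ipZl, ipZr).

Lemma ip_gt0 u : u != 0 -> 0 < ip u u.
Proof.
by move=> u0; rewrite lt0r ip_ge0 andbT; apply: contra_neq u0 => /ip_eq0.
Qed.

Lemma ip_cauchy_schwarz u v : ip u v ^+ 2 <= ip u u * ip v v.
Proof.
apply: discriminant_le0 => // t; have := ip_ge0 (u + t *: v).
by rewrite !ipE (ipC v u) => /le_trans; apply; rewrite le_eqVlt; apply/predU1P;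
  left; ring.
Qed.

Lemma ip_addr_le u v : ip (u + v) (u + v) <= 2 * ip u u + 2 * ip v v.
Proof. by have := ip_ge0 (u - v); rewrite !ipE (ipC v u); lra. Qed.

Lemma ip_unit u : u != 0 ->
  ip ((Num.sqrt (ip u u))^-1 *: u) ((Num.sqrt (ip u u))^-1 *: u) = 1.
Proof.
move=> u0; have ipu0 := ip_gt0 u0.
by rewrite !ipE mulrA -invfM -expr2 sqr_sqrtr // mulVf ?gt_eqF.
Qed.

Lemma ip_nondeg u v : (forall w, ip u w = ip v w) -> u = v.
Proof.
move=> uv; apply/eqP; rewrite -subr_eq0; apply/eqP/ip_eq0.
by rewrite ipDl ipNl uv subrr.
Qed.

Definition ip_cvg (u_ : nat -> V) u : Prop :=
  ip (u_ n - u) (u_ n - u) @[n --> \oo] --> (0 : R).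

Lemma ip_cvg_cst u : ip_cvg (fun=> u) u.
Proof. by rewrite /ip_cvg subrr ip0l; exact: cvg_cst. Qed.

Lemma ip_cvgD (u_ v_ : nat -> V) u v :
  ip_cvg u_ u -> ip_cvg v_ v -> ip_cvg (fun n => u_ n + v_ n) (u + v).
Proof.
move=> uu vv; apply: (@squeeze_cvgr _ _ _ _ (fun=> 0)
    (fun n => 2 * ip (u_ n - u) (u_ n - u) + 2 * ip (v_ n - v) (v_ n - v))).
- near=> n; rewrite ip_ge0/= opprD addrACA; exact: ip_addr_le.
- exact: cvg_cst.
- by apply: cvg_eqr (cvgD (cvg_mul0r 2 uu) (cvg_mul0r 2 vv)) _; rewrite addr0.
Unshelve. all: by end_near. Qed.

Lemma ip_cvgZ c (u_ : nat -> V) u : ip_cvg u_ u -> ip_cvg (fun n => c *: u_ n) (c *: u).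
Proof.
move=> uu; rewrite /ip_cvg.
under eq_cvg do rewrite -scalerBr ipZl ipZr mulrA.
exact: cvg_mul0r.
Qed.

Lemma ip_cvgB (u_ v_ : nat -> V) u v :
  ip_cvg u_ u -> ip_cvg v_ v -> ip_cvg (fun n => u_ n - v_ n) (u - v).
Proof.
move=> uu /(ip_cvgZ (-1)) vv; have := ip_cvgD uu vv.
by under eq_fun do rewrite scaleN1r; rewrite scaleN1r.
Qed.

Lemma cvg_ip (u_ v_ : nat -> V) u v : ip_cvg u_ u -> ip_cvg v_ v ->
  ip (u_ n) (v_ n) @[n --> \oo] --> ip u v.
Proof.
have weak (w_ : nat -> V) w z : ip_cvg w_ w -> ip (w_ n - w) z @[n --> \oo] --> (0 : R).
  move=> ww; apply: (@cvg_sqr_le0 _ _ (fun n => ip (w_ n - w) (w_ n - w) * ip z z)).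
    by move=> n; exact: ip_cauchy_schwarz.
  by apply: cvg_eqr (cvgMr_tmp ww) _; rewrite mul0r.
move=> uu vv.
(* Expansion around the limits: every term but the last tends to 0 by Cauchy-Schwarz. *)
have -> : (fun n => ip (u_ n) (v_ n)) = (fun n =>
    ip (u_ n - u) (v_ n - v) + ip (u_ n - u) v + ip (v_ n - v) u + ip u v).
  apply/funext => n; rewrite !ipE (ipC (v_ n) u) (ipC v u).
  by ring.
apply: (@cvg_eqr _ _ (0 + 0 + 0 + ip u v)); last by rewrite !add0r.
apply: cvgD; last exact: cvg_cst.
apply: cvgD; last exact: weak.
apply: cvgD; last exact: weak.
apply: (@cvg_sqr_le0 _ _ (fun n => ip (u_ n - u) (u_ n - u) *
    ip (v_ n - v) (v_ n - v))).
  by move=> n; exact: ip_cauchy_schwarz.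
by apply: cvg_eqr (cvgM uu vv) _; rewrite mul0r.
Qed.

Lemma ip_cvg_unique (u_ : nat -> V) u v : ip_cvg u_ u -> ip_cvg u_ v -> u = v.
Proof.
move=> uu uv; apply: ip_nondeg => w.
have := cvg_ip uu (ip_cvg_cst w); have := cvg_ip uv (ip_cvg_cst w).
by move=> + /cvg_lim => /cvg_lim <-// <-.
Qed.

Lemma ip_cvg_sub (u_ : nat -> V) u (phi : nat -> nat) :
  (forall k, (phi k < phi k.+1)%N) ->
  ip_cvg u_ u -> ip_cvg (u_ \o phi) u.
Proof. by move=> /strict_incr_cvg phio uu; exact: (cvg_comp _ _ phio uu). Qed.

(** * Symmetric and nonnegative operators *)

Section symmetric.
Variable B : V -> V.
Hypothesis B_sym : forall u v, ip (B u) v = ip u (B v).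

(** Linearity follows from symmetry and nondegeneracy, so an operator can be a bare function, such
    as an inverse obtained by choice. *)
Lemma symD u v : B (u + v) = B u + B v.
Proof. by apply: ip_nondeg => w; rewrite B_sym !ipDl !B_sym. Qed.

Lemma symZ c u : B (c *: u) = c *: B u.
Proof. by apply: ip_nondeg => w; rewrite B_sym !ipZl B_sym. Qed.

Lemma symB u v : B (u - v) = B u - B v.
Proof. by rewrite -scaleN1r symD symZ scaleN1r. Qed.

Lemma sym0 : B 0 = 0.
Proof. by have := symZ 0 0; rewrite !scale0r. Qed.

Hypothesis B_ge0 : forall u, 0 <= ip (B u) u.

(* Cauchy-Schwarz for the semi-inner product [ip (B u) v], applied to
   [v = B u]. *)
Lemma sym_ge0_norm_le (mu : R) u : ip (B (B u)) (B u) <= mu * ip (B u) (B u) ->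
  ip (B u) (B u) <= mu * ip (B u) u.
Proof.
move=> muB; have [Bu0|Bu0] := eqVneq (B u) 0.
  by rewrite Bu0 !ip0l mulr0.
have := ip_gt0 Bu0; set s := ip (B u) (B u) => s0.
have : s ^+ 2 <= ip (B u) u * ip (B (B u)) (B u).
  apply: discriminant_le0 => // t; have := B_ge0 (u + t *: B u).
  rewrite symD symZ !ipE -/s (B_sym (B u) u) -/s => /le_trans; apply.
  by rewrite le_eqVlt; apply/predU1P; left; ring.
rewrite expr2 => /le_trans/(_ (ler_wpM2l (B_ge0 u) muB)); rewrite -/s.
by rewrite mulrA ler_pM2r// mulrC.
Qed.

End symmetric.

Definition ip_compact (K : V -> V) := forall (u_ : nat -> V) (M : R),
  (forall n, ip (u_ n) (u_ n) <= M) ->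
  exists (phi : nat -> nat) v,
    (forall k, (phi k < phi k.+1)%N) /\ ip_cvg (K \o u_ \o phi) v.

(** * Compact operators: boundedness and top eigenvectors *)

Section compact.
Variable K : V -> V.
Hypothesis K_sym : forall u v, ip (K u) v = ip u (K v).
Hypothesis K_ge0 : forall u, 0 <= ip (K u) u.
Hypothesis K_compact : ip_compact K.

(** Otherwise unit vectors with [|K u_n|^2 > n] would have images with a convergent, hence bounded,
    subsequence. *)
Lemma compact_bounded : exists2 M, 0 < M & forall u, ip (K u) (K u) <= M * ip u u.
Proof.
apply: contrapT => unbd.
have /choice[u_ u_P] : forall n : nat, exists u,
    ip u u = 1 /\ n%:R < ip (K u) (K u).
  move=> n.
  have [u] : exists u, ~ (ip (K u) (K u) <= n.+1%:R * ip u u).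
    apply: contrapT => bd; apply: unbd; exists n.+1%:R => // u.
    by apply: contrapT => ?; apply: bd; exists u.
  move=> /negP; rewrite -ltNge => nu.
  have u0 : u != 0.
    by apply: contraTneq nu => ->; rewrite (sym0 K_sym) !ip0l mulr0 ltxx.
  exists ((Num.sqrt (ip u u))^-1 *: u); split; first exact: ip_unit.
  have ipu := ip_gt0 u0.
  rewrite (symZ K_sym) ipZl ipZr mulrA -invfM -expr2 sqr_sqrtr ?(ltW ipu)//.
  rewrite mulrC ltr_pdivlMr//; apply: le_lt_trans nu.
  by rewrite ler_wpM2r ?ler_nat// ltW.
have [|phi [v [incr Kv]]] := @K_compact u_ 1; first by move=> n; have [->] := u_P n.
have : ip ((K \o u_ \o phi) n) ((K \o u_ \o phi) n) @[n --> \oo] --> ip v v.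
  exact: cvg_ip.
move=> /cvgrPdist_lt/(_ _ ltr01)[N _ /= NP].
have := strict_incr_cvg incr; rewrite cvgnyPge => /(_ (Num.trunc (ip v v + 1)).+1).
move=> [N' _ /= N'P].
have := NP (maxn N N') (leq_maxl _ _); have := N'P (maxn N N') (leq_maxr _ _).
set m := phi _ => tm; have [_ mK] := u_P m.
rewrite ltr_distlC => /andP[_ Kv1].
have : ip v v + 1 < m%:R.
  apply: (@lt_le_trans _ _ (Num.trunc (ip v v + 1)).+1%:R); last by rewrite ler_nat.
  have := trunc_itv (_ : 0 <= ip v v + 1); rewrite addr_ge0// => /(_ isT).
  by case/andP.
by move: mK Kv1; lra.
Qed.

Lemma compact_cvg (u_ : nat -> V) u : ip_cvg u_ u -> ip_cvg (K \o u_) (K u).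
Proof.
have [M M0 KM] := compact_bounded; move=> uu.
apply: (@squeeze_cvgr _ _ _ _ (fun=> 0) (fun n => M * ip (u_ n - u) (u_ n - u))).
- by near=> n; rewrite ip_ge0/= -(symB K_sym) KM.
- exact: cvg_cst.
- exact: cvg_mul0r.
Unshelve. all: by end_near. Qed.

(* The supremum [mu] of [ip (K f) f] over the unit ball of the orthogonal
   complement of [E] is attained: along a maximizing sequence
   [|K f - mu f|^2 <= mu^2 - mu ip (K f) f] tends to 0, and K is compact. *)
Lemma compact_top_eigenvector (E : set V) (nu : R) f0 :
  (forall e, E e -> exists c, K e = c *: e) -> 0 < nu ->
  (forall e, E e -> ip f0 e = 0) -> nu * ip f0 f0 < ip (K f0) f0 ->
  exists (mu : R) h, [/\ nu < mu, h != 0, K h = mu *: h &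
    forall e, E e -> ip h e = 0].
Proof.
move=> EK nu0 f0E f0nu; have [M M0 KM] := compact_bounded.
pose P f := forall e, E e -> ip f e = 0.
have PK f : P f -> P (K f).
  by move=> Pf e Ee; have [c Kc] := EK e Ee; rewrite K_sym Kc ipZr Pf// mulr0.
have PZ c f : P f -> P (c *: f) by move=> Pf e Ee; rewrite ipZl Pf// mulr0.
pose S := [set r | exists f, [/\ P f, ip f f <= 1 & r = ip (K f) f]].
have supS : has_sup S.
  split; first by exists (ip (K 0) 0); exists 0; split => // [e _|];
    rewrite ip0l// ler01.
  (* The bound comes from [2 <K f, f> <= |K f|^2 + |f|^2]. *)
  exists (M + 1) => r [f [Pf f1 ->]].
  have := ip_ge0 (K f - f); have := KM f; rewrite !ipE (ipC f (K f)).
  have : M * ip f f <= M by rewrite ger_pMr.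
  have := K_ge0 f; have := ip_ge0 (K f); lra.
pose mu := sup S.
have Kmu f : P f -> ip (K f) f <= mu * ip f f.
  move=> Pf; have [->|fn0] := eqVneq f 0; first by rewrite !ip0r mulr0.
  have ipf := ip_gt0 fn0.
  have : S (ip (K ((Num.sqrt (ip f f))^-1 *: f)) ((Num.sqrt (ip f f))^-1 *: f)).
    by exists ((Num.sqrt (ip f f))^-1 *: f); split => //;
      [exact: PZ | rewrite ip_unit].
  move=> /(ub_le_sup supS.2); rewrite -/mu (symZ K_sym) ipZl ipZr mulrA -invfM.
  by rewrite -expr2 sqr_sqrtr ?(ltW ipf)// [_^-1 * _]mulrC ler_pdivrMr.
have f0n0 : f0 != 0.
  by apply: contraTneq f0nu => ->; rewrite (sym0 K_sym) !ip0l mulr0 ltxx.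
have numu : nu < mu.
  have := lt_le_trans f0nu (Kmu _ f0E).
  by rewrite ltr_pM2r// ip_gt0.
have mu0 : 0 < mu by exact: lt_trans numu.
have /choice[f_ f_P] : forall n : nat, exists f, [/\ P f, ip f f <= 1 &
    mu - n.+1%:R^-1 < ip (K f) f].
  move=> n.
  have n0 : (0 : R) < n.+1%:R^-1 by rewrite invr_gt0.
  by have [r [f [Pf f1 ->]] rmu] := sup_adherent n0 supS; exists f.
have [|phi [g [incr Kg]]] := @K_compact f_ 1; first by move=> n; have [] := f_P n.
have d0 : ip_cvg (fun n => K (f_ n) - mu *: f_ n) 0.
  rewrite /ip_cvg.
  apply: (@squeeze_cvgr _ _ _ _ (fun=> 0) (fun n => mu * n.+1%:R^-1)).
  - near=> n; rewrite ip_ge0/= subr0; have [Pf f1 fmu] := f_P n.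
    rewrite !ipE (ipC (f_ n) (K (f_ n))).
    have := sym_ge0_norm_le K_sym K_ge0 (Kmu _ (PK _ Pf)).
    have : mu * mu * ip (f_ n) (f_ n) <= mu * mu by rewrite ger_pMr ?mulr_gt0.
    have : mu * (mu - n.+1%:R^-1) < mu * ip (K (f_ n)) (f_ n) by rewrite ltr_pM2l.
    by set s := _^-1; nra.
  - exact: cvg_cst.
  - by apply: cvg_mul0r; exact: cvg_harmonic.
(* Since [mu f = K f - (K f - mu f)], the maximizing subsequence itself converges, to [mu^-1 g]. *)
pose h := mu^-1 *: g.
have fh : ip_cvg (f_ \o phi) h.
  have := ip_cvgZ mu^-1 (ip_cvgB Kg (ip_cvg_sub incr d0)).
  rewrite subr0 -/h; congr (ip_cvg _ h); apply/funext => n /=.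
  by rewrite opprB addrC subrK scalerA mulVf ?scale1r ?gt_eqF.
have Kh : K h = mu *: h.
  rewrite scalerA mulfV ?scale1r ?gt_eqF//.
  exact: ip_cvg_unique (compact_cvg fh) Kg.
exists mu, h; split => //.
  (* If [h] were 0, the forms [<K f, f>] would tend to 0 along the subsequence, although they exceed
     [mu] minus a null sequence. *)
  apply/eqP => h0.
  have := cvg_ip (compact_cvg fh) fh; rewrite h0 ip0r.
  move=> /(cvgr_lt _) /(_ _ (_ : 0 < mu / 2)); rewrite divr_gt0// => /(_ isT).
  have : (phi n).+1%:R^-1 @[n --> \oo] --> (0 : R).
    exact: (cvg_comp _ _ (strict_incr_cvg incr) (@cvg_harmonic R)).
  move=> /(cvgr_lt _) /(_ _ (_ : 0 < mu / 2)); rewrite divr_gt0// => /(_ isT).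
  move=> [N1 _ N1P] [N2 _ N2P].
  have /= := N1P (maxn N1 N2) (leq_maxl _ _).
  have /= := N2P (maxn N1 N2) (leq_maxr _ _).
  by have [_ _] /= := f_P (phi (maxn N1 N2)); set d := _.+1%:R^-1; lra.
move=> e Ee; have := cvg_ip fh (ip_cvg_cst e).
have -> : (fun n => ip ((f_ \o phi) n) e) = fun=> 0.
  by apply/funext => n; have [Pf _ _] := f_P (phi n); exact: Pf.
by move=> /cvg_lim <-//; rewrite lim_cst.
Unshelve. all: by end_near. Qed.

(** * The Fredholm alternative for [1 - lambda K] *)

Section fredholm.
Hypothesis complete : forall u_ : nat -> V,
  (forall e, 0 < e -> exists N : nat, forall m n, (N <= m)%N -> (N <= n)%N ->
     ip (u_ m - u_ n) (u_ m - u_ n) <= e) -> exists u, ip_cvg u_ u.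
Variable lambda : R.
Hypothesis not_eigen : forall u, u = lambda *: K u -> u = 0.
Let T u := u - lambda *: K u.

Let T_sym u v : ip (T u) v = ip u (T v).
Proof. by rewrite /T !ipE K_sym. Qed.

Lemma contraction_fixpoint (S : V -> V) (q : R) g :
  (forall u v, ip (S u) v = ip u (S v)) -> 0 <= q -> q < 1 ->
  (forall u, ip (S u) (S u) <= q * ip u u) -> exists u, u = S u + g.
Proof.
move=> S_sym q0 q1 Sq.
pose u_ n := iter n (fun u => S u + g) 0.
(* In [|v + g|^2 <= (1 + t) |v|^2 + (1 + t^-1) |g|^2] this [t] ensures [(1 + t) q + t <= 1], so the
   iteration preserves the bound [bnd] on squared norms. *)
pose t := (1 - q) / 2; have t0 : 0 < t by rewrite /t; lra.
pose bnd := (1 + t^-1) * ip g g * t^-1.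
have t'0 : 0 < t^-1 by rewrite invr_gt0.
have bnd0 : 0 <= bnd by rewrite !mulr_ge0// ?ltW// addr_gt0.
have bndE : t * bnd = (1 + t^-1) * ip g g.
  by rewrite /bnd mulrC mulfVK// gt_eqF.
have u_bnd n : ip (u_ n) (u_ n) <= bnd.
  elim: n => [|n IH]; first by rewrite ip0l.
  rewrite /u_ iterS -/(u_ n).
  apply: (@le_trans _ _ ((1 + t) * ip (S (u_ n)) (S (u_ n)) +
      (1 + t^-1) * ip g g)).
    have := ip_ge0 (S (u_ n) - t^-1 *: g).
    rewrite !ipE (ipC g (S _)) => /(mulr_ge0 (ltW t0)).
    set A := ip (S _) (S _); set B := ip (S _) g; set D := ip g g => H.
    rewrite -subr_ge0; apply: le_trans H _; rewrite le_eqVlt; apply/predU1P; left.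
    by field; rewrite gt_eqF.
  rewrite -bndE.
  have Squ : ip (S (u_ n)) (S (u_ n)) <= q * bnd.
    by apply: le_trans (Sq _) _; exact: ler_wpM2l.
  have : (1 + t) * ip (S (u_ n)) (S (u_ n)) <= (1 + t) * (q * bnd).
    by apply: ler_wpM2l => //; lra.
  have : 0 <= bnd * (1 - (1 + t) * q - t).
    apply: mulr_ge0 => //; have -> : 1 - (1 + t) * q - t = t * (1 - q).
      by rewrite /t; field.
    by rewrite mulr_ge0// ?ltW// subr_gt0.
  lra.
(* The difference is [S] iterated [n] times on [u_ k], and [q] is a ratio of squared norms. *)
have u_diff n k : ip (u_ (n + k)%N - u_ n) (u_ (n + k)%N - u_ n) <= q ^+ n * bnd.
  elim: n => [|n IH]; first by rewrite add0n expr0 mul1r subr0.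
  rewrite addSn /u_ !iterS -!/(u_ _) opprD addrACA subrr addr0 -(symB S_sym).
  by apply: le_trans (Sq _) _; rewrite exprS -mulrA; exact: ler_wpM2l.
have qn0 : q ^+ n * bnd @[n --> \oo] --> (0 : R).
  apply: (@cvg_eqr _ _ (0 * bnd)); last by rewrite mul0r.
  by apply: cvgMr_tmp; apply: cvg_expr; rewrite ger0_norm.
have [|u uu] := @complete u_.
  (* A quarter, because [|v + w|^2 <= 2 |v|^2 + 2 |w|^2] is used to pass through [u_ N]. *)
  move=> e e0; have e40 : 0 < e / 4 by rewrite divr_gt0.
  move/cvgr_lt : qn0 => /(_ _ e40)[N _ NP]; exists N => m n Nm Nn.
  have := u_diff N (m - N)%N; have := u_diff N (n - N)%N; rewrite !subnKC//.
  have := NP N (leqnn N) => /=.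
  have := ip_addr_le (u_ m - u_ N) (- (u_ n - u_ N)).
  by rewrite ipNl ipNr opprK opprB addrA subrK; lra.
exists u.
have uS : ip_cvg (fun n => u_ n.+1) u.
  by apply: (@ip_cvg_sub u_ u succn) uu.
apply: (ip_cvg_unique uS).
apply: (@ip_cvgD (fun n => S (u_ n)) (fun=> g)); last exact: ip_cvg_cst.
apply: (@squeeze_cvgr _ _ _ _ (fun=> 0) (fun n => q * ip (u_ n - u) (u_ n - u))).
- by near=> n; rewrite ip_ge0/= -(symB S_sym) Sq.
- exact: cvg_cst.
- exact: cvg_mul0r.
Unshelve. all: by end_near. Qed.

(** If unit vectors have [T u_n] tending to 0, compactness makes a subsequence of them converge to a
    solution of [u = lambda K u]; that limit is 0, contradicting norm one. *)
Lemma fredholm_bounded_below : exists2 c, 0 < c & forall u, c * ip u u <= ip (T u) (T u).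
Proof.
apply: contrapT => unbd.
have /choice[u_ u_P] : forall n : nat, exists u,
    ip u u = 1 /\ ip (T u) (T u) < n.+1%:R^-1.
  move=> n.
  have [u] : exists u, ~ (n.+1%:R^-1 * ip u u <= ip (T u) (T u)).
    apply: contrapT => bd; apply: unbd; exists n.+1%:R^-1.
      by rewrite invr_gt0.
    by move=> u; apply: contrapT => ?; apply: bd; exists u.
  move=> /negP; rewrite -ltNge => nu.
  have u0 : u != 0.
    by apply: contraTneq nu => ->; rewrite (sym0 T_sym) !ip0l mulr0 ltxx.
  exists ((Num.sqrt (ip u u))^-1 *: u); split; first exact: ip_unit.
  have ipu := ip_gt0 u0.
  rewrite (symZ T_sym) ipZl ipZr mulrA -invfM -expr2 sqr_sqrtr ?(ltW ipu)//.
  by rewrite mulrC ltr_pdivrMr.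
have [|phi [g [incr Kg]]] := @K_compact u_ 1; first by move=> n; have [->] := u_P n.
have Tu0 : ip_cvg (T \o u_) 0.
  apply: (@squeeze_cvgr _ _ _ _ (fun=> 0) (fun n => n.+1%:R^-1)).
  - by near=> n; rewrite ip_ge0/= subr0 ltW//; have [] := u_P n.
  - exact: cvg_cst.
  - exact: cvg_harmonic.
have ug : ip_cvg (u_ \o phi) (lambda *: g).
  have := ip_cvgD (ip_cvg_sub incr Tu0) (ip_cvgZ lambda Kg); rewrite add0r.
  by congr (ip_cvg _ _); apply/funext => n /=; rewrite /T subrK.
have Kg' : K (lambda *: g) = g := ip_cvg_unique (compact_cvg ug) Kg.
have g0 : lambda *: g = 0 by apply: not_eigen; rewrite Kg'.
have := cvg_ip ug ug; rewrite g0 ip0l.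
have -> : (fun n => ip ((u_ \o phi) n) ((u_ \o phi) n)) = fun=> 1.
  by apply/funext => n; have [] := u_P (phi n).
by move=> /cvg_lim; rewrite lim_cst// => /(_ (@Rhausdorff R))/eqP; rewrite oner_eq0.
Unshelve. all: by end_near. Qed.

(* [S = 1 - T^2 / C] is a symmetric contraction when [c <= T^2 <= C] with
   [0 < c], so the fixed-point iteration for [u = S u + f / C] converges and
   solves [T (T u) = f]. *)
Lemma fredholm_surjective f : exists u, T u = f.
Proof.
have [c c0 Tc] := fredholm_bounded_below.
have [M M0 KM] := compact_bounded.
(* The first two terms bound [T^2] from above; adding [c] gives [c <= C], hence [0 <= q]. *)
pose C := 2 + 2 * lambda ^+ 2 * M + c.
have l20 : 0 <= lambda ^+ 2 by exact: sqr_ge0.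
have lM0 : 0 <= lambda ^+ 2 * M by rewrite mulr_ge0// ltW.
have C0 : 0 < C by rewrite /C; lra.
have TC u : ip (T u) (T u) <= C * ip u u.
  have := ip_addr_le u (- (lambda *: K u)); rewrite -/(T u) !ipE.
  have := ler_wpM2l l20 (KM u); have := ip_ge0 u; rewrite /C.
  have := mulr_ge0 (ltW c0) (ip_ge0 u).
  by nra.
pose q := 1 - c / C.
have q0 : 0 <= q.
  by rewrite subr_ge0 ler_pdivrMr// mul1r /C; lra.
have q1 : q < 1 by rewrite ltrBlDr ltrDl divr_gt0.
pose S u := u - C^-1 *: T (T u).
have S_sym u v : ip (S u) v = ip u (S v)
  by rewrite /S ipDl ipNl ipZl ipDr ipNr ipZr !T_sym.
have Sform u : ip (S u) u = ip u u - C^-1 * ip (T u) (T u).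
  by rewrite /S ipDl ipNl ipZl T_sym.
have S_ge0 u : 0 <= ip (S u) u.
  by rewrite Sform subr_ge0 mulrC ler_pdivrMr// mulrC TC.
have S_le u : ip (S u) u <= q * ip u u.
  rewrite Sform /q mulrBl mul1r lerD2l lerN2 mulrAC mulrC.
  by rewrite ler_pM2l ?invr_gt0.
have S_contr u : ip (S u) (S u) <= q * ip u u.
  apply: le_trans (sym_ge0_norm_le S_sym S_ge0 (S_le _)) _.
  rewrite ler_wpM2l//; apply: le_trans (S_le u) _.
  by rewrite ler_piMl// ltW.
have [u uE] := contraction_fixpoint (C^-1 *: f) S_sym q0 q1 S_contr.
exists (T u); apply/eqP; rewrite -subr_eq0; apply/eqP.
have C'0 : C^-1 != 0 by rewrite invr_eq0 gt_eqF.
apply: (scalerI C'0); rewrite scaler0 scalerBr; apply/eqP.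
rewrite subr_eq0 eq_sym -subr_eq0; apply/eqP.
by move: uE; rewrite /S -addrA [RHS]addrC => /eqP; rewrite -subr_eq subrr;
  rewrite eq_sym addrC => /eqP.
Qed.

End fredholm.
End compact.
End real_hilbert.

(** * The space l^2 as a real Hilbert space *)

Lemma cvg_bigsum (R : realType) (I : Type) (r : seq I) (P : pred I)
    (f : I -> nat -> R) (l : I -> R) :
  (forall i, P i -> f i n @[n --> \oo] --> l i) ->
  \sum_(i <- r | P i) f i n @[n --> \oo] --> \sum_(i <- r | P i) l i.
Proof.
move=> fl; elim: r => [|i r IH].
  by under eq_fun do rewrite big_nil; rewrite big_nil; exact: cvg_cst.
under eq_fun do rewrite big_cons; rewrite big_cons.
by case: ifPn => // Pi; apply: cvgD => //; exact: fl.
Qed.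

Section ell2_space.
Context {R : realType}.
Local Notation Re := complex.Re.
Local Notation Im := complex.Im.

(* The complex space l^2 is treated as a real Hilbert space with inner product
   [Re (dot u v)]; [Rcomplex R] below is R[i] with its real vector space
   structure. *)
Definition rdot (u v : nat -> R[i]) : R :=
  limn (series (fun n => Re (u n) * Re (v n) + Im (u n) * Im (v n))).

Lemma normc_sqr (z : R[i]) : Normc.normc z ^+ 2 = Re z ^+ 2 + Im z ^+ 2.
Proof. by case: z => x y /=; rewrite sqr_sqrtr// addr_ge0// sqr_ge0. Qed.

Lemma ell2E (u : nat -> R[i]) :
  ell2 u = cvgn (series (fun n => Re (u n) ^+ 2 + Im (u n) ^+ 2)).
Proof. by congr (cvgn (series _)); apply/funext => n; rewrite normc_sqr. Qed.

Lemma ell2_normE (u : nat -> R[i]) : ell2_norm u = Num.sqrt (rdot u u).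
Proof.
by congr (Num.sqrt (limn (series _))); apply/funext => n; rewrite normc_sqr.
Qed.

Lemma Re_dot (u v : nat -> R[i]) : Re (dot u v) = rdot u v.
Proof.
rewrite /dot /csum /=; congr (limn (series _)); apply/funext => n.
by case: (u n) (v n) => [x y] [z t] /=; ring.
Qed.

(** With [Re_dot], this recovers the complex inner product from the real one by pairing also with
    [i v]. *)
Lemma Im_dot (u v : nat -> R[i]) : Im (dot u v) = rdot u (fun n => 'i * v n).
Proof.
rewrite /dot /csum /=; congr (limn (series _)); apply/funext => n.
by case: (u n) (v n) => [x y] [z t] /=; ring.
Qed.

Lemma eventually_cst_cvg (s : nat -> R) l N :
  (forall n, (N <= n)%N -> s n = l) -> s n @[n --> \oo] --> l.
Proof.
move=> sl; apply: cvg_near_cst; exists N => // n /= Nn; rewrite sl//.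
Qed.

Lemma finite_series_cvg (s : nat -> R) N : (forall n, (N <= n)%N -> s n = 0) ->
  series s n @[n --> \oo] --> \sum_(n < N) s n.
Proof.
move=> s0; apply: (@eventually_cst_cvg _ _ N) => n Nn.
rewrite seriesEord /= -(subnKC Nn) big_split_ord /= [X in _ + X]big1 ?addr0// => i _.
by rewrite s0// leq_addr.
Qed.

Lemma ell2_finite (u : nat -> R[i]) N : (forall n, (N <= n)%N -> u n = 0) -> ell2 u.
Proof.
move=> u0; rewrite ell2E; apply: cvgP; apply: (@finite_series_cvg _ N) => n Nn.
by rewrite u0//= expr0n addr0.
Qed.

Lemma rdot_finite (u v : nat -> R[i]) N : (forall n, (N <= n)%N -> u n = 0) ->
  rdot u v = \sum_(n < N) (Re (u n) * Re (v n) + Im (u n) * Im (v n)).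
Proof.
move=> u0; apply: cvg_lim => //; apply: finite_series_cvg => n Nn.
by rewrite u0//= !mul0r addr0.
Qed.

Definition ell2_pred : {pred nat -> Rcomplex R} := fun u => `[< ell2 u >].

(** Bundling square-summability makes l^2 a real vector space to which the abstract lemmas apply;
    [mkl2] and [l2P] pass to and from bare sequences. *)
Record l2 := L2 { l2val :> nat -> Rcomplex R ; _ : l2val \in ell2_pred }.
HB.instance Definition _ := [isSub of l2 for l2val].
HB.instance Definition _ := [Choice of l2 by <:].

Lemma ell2_submod_closed : submod_closed ell2_pred.
Proof.
split=> [|a u v].
  by apply/asboolP; apply: (@ell2_finite _ 0).
rewrite !unfold_in => /asboolP; rewrite ell2E => uu /asboolP; rewrite ell2E => vv.
apply/asboolP; rewrite ell2E.
(* The majorant comes from [|a u + v|^2 <= 2 a^2 |u|^2 + 2 |v|^2]. *)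
apply: (@series_le_cvg _ _ (fun n =>
  2 * a ^+ 2 * (Re (u n) ^+ 2 + Im (u n) ^+ 2) +
  2 * (Re (v n) ^+ 2 + Im (v n) ^+ 2))).
- by move=> n; rewrite addr_ge0// sqr_ge0.
- by move=> n; apply: addr_ge0; apply: mulr_ge0;
    rewrite ?addr_ge0 ?sqr_ge0// pmulr_rge0// sqr_ge0.
- move=> n; rewrite !fctE /=; case: (u n) (v n) => [x y] [z t] /=.
  have := sqr_ge0 (a * x - z); have := sqr_ge0 (a * y - t); nra.
- by apply: is_cvg_seriesD; apply: is_cvg_seriesZ.
Qed.

HB.instance Definition _ :=
  GRing.isSubmodClosed.Build R (nat -> Rcomplex R) ell2_pred ell2_submod_closed.
HB.instance Definition _ := [SubChoice_isSubLmodule of l2 by <:].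

Lemma l2D (u v : l2) n : (u + v : l2) n = u n + v n.
Proof. by []. Qed.

Lemma l2B (u v : l2) n : (u - v : l2) n = u n - v n.
Proof. by []. Qed.

Lemma l2Z c (u : l2) n : (c *: u : l2) n = c *: u n.
Proof. by []. Qed.

Definition mkl2 (u : nat -> R[i]) (ell2_u : ell2 u) : l2 :=
  @L2 u (asboolT ell2_u).

Lemma l2P (u : l2) : ell2 u.
Proof. by case: u => u uP; exact/asboolP. Qed.
Arguments l2P u : clear implicits.

Definition ip (u v : l2) : R := rdot u v.

(** By polarization the terms are half of [|u + v|^2 - |u|^2 - |v|^2], each of which is summable. *)
Lemma ip_is_cvg (u v : l2) :
  cvgn (series (fun n => Re (u n) * Re (v n) + Im (u n) * Im (v n))).
Proof.
have := l2P (u + v); have := l2P u; have := l2P v; rewrite !ell2E => vv uu uv.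
have -> : (fun n => Re (u n) * Re (v n) + Im (u n) * Im (v n)) =
  2^-1 *: (((fun n => Re ((u + v : l2) n) ^+ 2 + Im ((u + v : l2) n) ^+ 2) -
   (fun n => Re (u n) ^+ 2 + Im (u n) ^+ 2)) -
   (fun n => Re (v n) ^+ 2 + Im (v n) ^+ 2)) :> (nat -> R).
  apply/funext => n; rewrite !fctE !l2D /=.
  by case: (u n) (v n) => [x y] [z t] /=; rewrite /GRing.scale /=; field.
by apply: is_cvg_seriesZ; apply: is_cvg_seriesB => //; apply: is_cvg_seriesB.
Qed.

Arguments ip_is_cvg u v : clear implicits.

Lemma ipC (u v : l2) : ip u v = ip v u.
Proof.
by congr (limn (series _)); apply/funext => n; rewrite mulrC (mulrC (Im _)).
Qed.

Lemma ipDl (u v w : l2) : ip (u + v) w = ip u w + ip v w.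
Proof.
rewrite /ip /rdot -lim_seriesD; [|exact: ip_is_cvg..].
congr (limn (series _)); apply/funext => n.
rewrite fctE l2D.
by case: (u n) (v n) (w n) => [x y] [z t] [p q] /=; ring.
Qed.

Lemma ipZl c (u v : l2) : ip (c *: u) v = c * ip u v.
Proof.
apply: etrans (lim_seriesZ c (ip_is_cvg u v)).
congr (limn (series _)); apply/funext => n.
rewrite l2Z -[RHS]/(c * (Re (u n) * Re (v n) + Im (u n) * Im (v n))).
by case: (u n) (v n) => [x y] [z t] /=; rewrite /GRing.scale /=; ring.
Qed.

Lemma ip_sum_le (u : l2) N :
  \sum_(n < N) (Re (u n) ^+ 2 + Im (u n) ^+ 2) <= ip u u.
Proof.
have nd : nondecreasing_seq (series (fun n =>
    Re (u n) * Re (u n) + Im (u n) * Im (u n))).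
  by apply: nondecreasing_series => n _ _; rewrite addr_ge0// -expr2 sqr_ge0.
apply: le_trans (nondecreasing_cvgn_le nd (ip_is_cvg u u) N).
by rewrite seriesEord.
Qed.

Lemma ip_coord_le (u : l2) n : Re (u n) ^+ 2 + Im (u n) ^+ 2 <= ip u u.
Proof.
apply: le_trans (ip_sum_le u n.+1); rewrite big_ord_recr /= lerDr sumr_ge0// => i _.
by rewrite addr_ge0// sqr_ge0.
Qed.

Lemma ip_ge0 (u : l2) : 0 <= ip u u.
Proof. by apply: le_trans (ip_sum_le u 0); rewrite big_ord0. Qed.

Lemma l2_eqP (u v : l2) : (forall n, u n = v n) -> u = v.
Proof. by move=> uv; apply: val_inj; apply/funext. Qed.

Lemma ip_eq0 (u : l2) : ip u u = 0 -> u = 0.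
Proof.
move=> u0; apply: l2_eqP => n; have := ip_coord_le u n; rewrite u0.
case: (u n) => x y /= xy; have : x ^+ 2 = 0 /\ y ^+ 2 = 0.
  by have := sqr_ge0 x; have := sqr_ge0 y; split; lra.
by case=> /eqP + /eqP; rewrite !sqrf_eq0 => /eqP -> /eqP ->.
Qed.

Lemma ip_inner : inner_product ip.
Proof. by split; [exact: ipC|exact: ipDl|exact: ipZl|exact: ip_ge0|exact: ip_eq0]. Qed.

Lemma l2_complete (u_ : nat -> l2) :
  (forall e : R, 0 < e -> exists N : nat, forall m n, (N <= m)%N -> (N <= n)%N ->
     ip (u_ m - u_ n) (u_ m - u_ n) <= e) -> exists u, ip_cvg (ip := ip) u_ u.
Proof.
move=> cau.
have coordB m n k : (u_ m - u_ n : l2) k = u_ m k - u_ n k.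
  exact: l2B.
have cvg_coord (s : nat -> R) k :
    (forall m n, (s m - s n) ^+ 2 <=
      Re ((u_ m - u_ n : l2) k) ^+ 2 + Im ((u_ m - u_ n : l2) k) ^+ 2) ->
    cvgn s.
  move=> sP; apply/cauchy_cvgP/cauchy_exP => e e0.
  have [N NP] := cau ((e / 2) ^+ 2) (exprn_gt0 _ (divr_gt0 e0 (ltr0Sn _ _))).
  exists (s N); exists N => // n /= Nn; rewrite /ball /=.
  apply: (@le_lt_trans _ _ (e / 2)); last by rewrite ltr_pdivrMr// ltr_pMr// ltr1n.
  rewrite -(@ler_pXn2r _ 2)// ?nnegrE// ?divr_ge0 ?(ltW e0)// real_normK ?num_real//.
  exact: le_trans (sP _ _) (le_trans (ip_coord_le _ _) (NP _ _ (leqnn N) Nn)).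
have cRe k : cvgn (fun m => Re (u_ m k)).
  apply: (@cvg_coord _ k) => m n; rewrite coordB /=.
  by case: (u_ m k) (u_ n k) => [p q] [r t] /=; rewrite lerDl sqr_ge0.
have cIm k : cvgn (fun m => Im (u_ m k)).
  apply: (@cvg_coord _ k) => m n; rewrite coordB /=.
  by case: (u_ m k) (u_ n k) => [p q] [r t] /=; rewrite lerDr sqr_ge0.
pose w k : Rcomplex R := limn (fun m => Re (u_ m k)) +i* limn (fun m => Im (u_ m k)).
(* For fixed [m] and finitely many coordinates, [n] tends to infinity in the Cauchy condition. *)
have tail e N : (forall m n, (N <= m)%N -> (N <= n)%N ->
     ip (u_ m - u_ n) (u_ m - u_ n) <= e) -> forall m K, (N <= m)%N ->
   \sum_(k < K) (Re (u_ m k - w k) ^+ 2 + Im (u_ m k - w k) ^+ 2) <= e.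
  move=> NP m K Nm.
  have cvs : \sum_(k < K) (Re (u_ m k - u_ n k) ^+ 2 + Im (u_ m k - u_ n k) ^+ 2)
     @[n --> \oo] --> \sum_(k < K) (Re (u_ m k - w k) ^+ 2 + Im (u_ m k - w k) ^+ 2).
    apply: cvg_bigsum => k _.
    have Re_cvg : Re (u_ m k - u_ n k) @[n --> \oo] --> Re (u_ m k - w k).
      rewrite raddfB /=; under eq_fun do rewrite raddfB /=.
      by apply: cvgB; [exact: cvg_cst|exact: cRe].
    have Im_cvg : Im (u_ m k - u_ n k) @[n --> \oo] --> Im (u_ m k - w k).
      rewrite raddfB /=; under eq_fun do rewrite raddfB /=.
      by apply: cvgB; [exact: cvg_cst|exact: cIm].
    by apply: cvgD; rewrite expr2; under eq_fun do rewrite expr2; apply: cvgM.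
  apply: (cvgr_to_le cvs); exists N => // n /= Nn.
  apply: le_trans (NP m n Nm Nn); apply: le_trans (ip_sum_le _ K).
  by apply: ler_sum => k _; rewrite coordB.
have tail_ell2 e N : (forall m n, (N <= m)%N -> (N <= n)%N ->
     ip (u_ m - u_ n) (u_ m - u_ n) <= e) -> forall m, (N <= m)%N ->
   ell2 (fun k => u_ m k - w k).
  move=> NP m Nm; rewrite ell2E; apply: nondecreasing_is_cvgn.
    by apply: nondecreasing_series => n _ _; rewrite addr_ge0// sqr_ge0.
  by exists e => _ [K _ <-]; rewrite seriesEord; exact: (tail e N).
have w_ell2 : ell2 w.
  have [N NP] := cau 1 ltr01.
  (* The limit is [u_ N] minus the square-summable difference [u_ N - w]. *)
  have := l2P (u_ N - mkl2 (tail_ell2 1 N NP N (leqnn N))).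
  congr (ell2 _); apply/funext => k.
  rewrite l2B.
  by rewrite opprB addrC subrK.
exists (mkl2 w_ell2).
apply/cvgr0Pnorm_le => e e0; have [N NP] := cau e e0; exists N => // m /= Nm.
rewrite ger0_norm ?ip_ge0//; apply: limr_le; first exact: ip_is_cvg.
exists 0%N => // K _; rewrite seriesEord; apply: le_trans (tail e N NP m K Nm).
by apply: ler_sum => k _; rewrite -!expr2 l2B.
Qed.

End ell2_space.
Arguments l2 : clear implicits.
Arguments l2P {R} u.
Arguments ip_is_cvg {R} u v.

(** * The Jacobi operator and its Friedrichs extension *)

Section ell2_operators.
Context {R : realType}.
Local Notation Re := (@complex.Re R).
Local Notation Im := (@complex.Im R).
Local Notation l2 := (l2 R).

Lemma ell2_norm_l2 (u : l2) : ell2_norm u = Num.sqrt (ip u u).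
Proof. exact: ell2_normE. Qed.

Lemma ell2_cvgP (u_ : nat -> l2) (u : l2) :
  ell2_cvg (fun k => u_ k) u <-> ip_cvg (ip := ip) u_ u.
Proof.
have normE k : ell2_norm ((u_ k : nat -> R[i]) \- u) ^+ 2 = ip (u_ k - u) (u_ k - u).
  by rewrite ell2_normE sqr_sqrtr// (ip_ge0 (u_ k - u)).
split=> [[_ _ uu]|uu].
  apply: cvg_eqr; last by rewrite -(mulr0 0).
  by under eq_fun do rewrite -normE expr2; exact: cvgM.
split; [by move=> k; exact: l2P|exact: l2P|].
by apply: cvg_sqr_le0 uu => k; rewrite normE.
Qed.

Lemma ell2_cvg_l2 (u_ : nat -> nat -> R[i]) u : ell2_cvg u_ u ->
  exists (w_ : nat -> l2) (w : l2),
    [/\ (fun k => w_ k : nat -> R[i]) = u_, (w : nat -> R[i]) = u &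
        ip_cvg (ip := ip) w_ w].
Proof.
move=> uu; have [u_2 u2 _] := uu.
exists (fun k => mkl2 (u_2 k)), (mkl2 u2); split => //.
exact/ell2_cvgP.
Qed.

Lemma muli_ell2 (u : l2) : ell2 (fun n => 'i * u n).
Proof.
rewrite ell2E; have := l2P u; rewrite ell2E.
suff -> : (fun n => Re (u n) ^+ 2 + Im (u n) ^+ 2) =
  (fun n => Re ('i * u n) ^+ 2 + Im ('i * u n) ^+ 2) by [].
apply/funext => n; by case: (u n) => x y /=; ring.
Qed.

(** The complex structure of the real Hilbert space: a complex inner product identity splits into a
    real one and its analogue with [muli] applied. *)
Definition muli (u : l2) : l2 := mkl2 (@muli_ell2 u).

Lemma ip_muli (u v : l2) : ip (muli u) (muli v) = ip u v.
Proof.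
congr (limn (series _)); apply/funext => n /=.
by case: (u n) (v n) => [x y] [z t] /=; ring.
Qed.

Lemma muliK (u : l2) : muli (muli u) = - u.
Proof.
apply: l2_eqP => n /=; rewrite mulrA -expr2 sqr_i mulN1r.
by have /= := l2B 0 u n; rewrite !sub0r.
Qed.

Lemma muliB (u v : l2) : muli (u - v) = muli u - muli v.
Proof. by apply: l2_eqP => n; rewrite l2B /= mulrBr. Qed.

Lemma muliZ c (u : l2) : muli (c *: u) = c *: muli u.
Proof.
apply: l2_eqP => n; rewrite [RHS]l2Z.
rewrite -[LHS]/('i * (c *: u : l2) n) l2Z -[muli u n]/('i * u n).
by case: (u n) => p q; apply/eqP; rewrite eq_complex /=;
  apply/andP; split; apply/eqP; ring.
Qed.

Lemma dot_l2 (u v : l2) : dot u v = ip u v +i* ip u (muli v).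
Proof.
rewrite -[RHS]/(rdot u v +i* rdot u (fun n => 'i * v n)) -Re_dot -Im_dot.
by case: dot.
Qed.

Lemma dot_eq (x y u v : l2) : dot y u = dot x v <->
  ip y u = ip x v /\ ip y (muli u) = ip x (muli v).
Proof. by rewrite !dot_l2; split=> [[-> ->]|[-> ->]]. Qed.

End ell2_operators.

Section jacobi_operator.
Context {R : realType} (a b : nat -> R).
Hypothesis a_gt0 : forall n, 0 < a n.
Hypothesis J_pos : positive_operator (jacobi a b).
Local Notation Re := (@complex.Re R).
Local Notation Im := (@complex.Im R).
Local Notation l2 := (l2 R).
Local Notation l2_cvg := (ip_cvg (ip := @ip R)).
Local Notation J := (jacobi a b).
Local Notation J0 := (jacobi_finite a b).
Local Notation A := (friedrichs (jacobi a b)).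
Implicit Types u v w f g x y : l2.

Lemma Re_jacobi_action (u : nat -> R[i]) n :
  Re (jacobi_action a b u n) = jacobi_real a b (Re \o u) n.
Proof.
rewrite /jacobi_action /jacobi_real /=.
case: n => [|n]; case: (u _) => ? ?; case: (u _) => ? ? /=; first by ring.
by case: (u _) => ? ? /=; ring.
Qed.

Lemma Im_jacobi_action (u : nat -> R[i]) n :
  Im (jacobi_action a b u n) = jacobi_real a b (Im \o u) n.
Proof.
rewrite /jacobi_action /jacobi_real /=.
case: n => [|n]; case: (u _) => ? ?; case: (u _) => ? ? /=; first by ring.
by case: (u _) => ? ? /=; ring.
Qed.

Lemma jacobi_action_finite (u : nat -> R[i]) N : (forall n, (N <= n)%N -> u n = 0) ->
  forall n, (N < n)%N -> jacobi_action a b u n = 0.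
Proof.
move=> u0 [//|n] Nn; rewrite /jacobi_action !u0 ?mulr0 ?addr0//; by do ?apply: leqW.
Qed.

Lemma rdot_jacobi_action (x v : nat -> R[i]) N :
  (forall n, (N <= n)%N -> x n = 0) ->
  rdot (jacobi_action a b x) v = rdot x (jacobi_action a b v).
Proof.
move=> x0; rewrite (rdot_finite _ x0) (rdot_finite _ (jacobi_action_finite x0)).
rewrite !big_split /=.
under [in LHS]eq_bigr do rewrite Re_jacobi_action.
under [X in _ + X = _]eq_bigr do rewrite Im_jacobi_action.
under [in RHS]eq_bigr do rewrite Re_jacobi_action.
under [X in _ = _ + X]eq_bigr do rewrite Im_jacobi_action.
rewrite (@jacobi_real_finite_sym _ a b (Re \o x) (Re \o v))/=; last first.
  by move=> m Nm; rewrite x0.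
by rewrite (@jacobi_real_finite_sym _ a b (Im \o x) (Im \o v))//= => m Nm; rewrite x0.
Qed.

Lemma jacobi_finite_muli u f : J0 u f -> J0 (muli u) (muli f).
Proof.
move=> [[N u0] fE]; split; first by exists N => n Nn /=; rewrite u0// mulr0.
apply/funext => n; rewrite /= fE /jacobi_action !mulrDr.
by case: n => [|n]; rewrite ?mulr0 !(mulrCA 'i).
Qed.

Lemma jacobi_finiteD t u f v g : J0 u f -> J0 v g -> J0 (u + t *: v) (f + t *: g).
Proof.
move=> [[N u0] fE] [[M v0] gE]; split.
  exists (maxn N M) => n; rewrite geq_max => /andP[Nn Mn].
  by rewrite l2D l2Z u0// v0// scaler0 addr0.
apply/funext => n; rewrite l2D l2Z fE gE.
have ReE (z w : Rcomplex R) : Re (z + t *: w) = Re z + t * Re w.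
  by case: z w => [? ?] [? ?].
have ImE (z w : Rcomplex R) : Im (z + t *: w) = Im z + t * Im w.
  by case: z w => [? ?] [? ?].
apply/eqP; rewrite eq_complex; apply/andP.
split; apply/eqP; rewrite ?Re_jacobi_action ?Im_jacobi_action.
  rewrite ReE !Re_jacobi_action /jacobi_real /comp.
  have hR m : Re ((u + t *: v : l2) m) = Re (u m) + t * Re (v m) := ReE _ _.
  by case: n => [|n]; rewrite !hR; ring.
rewrite ImE !Im_jacobi_action /jacobi_real /comp.
have hI m : Im ((u + t *: v : l2) m) = Im (u m) + t * Im (v m) := ImE _ _.
by case: n => [|n]; rewrite !hI; ring.
Qed.

Lemma jacobi_approx u f : J u f -> exists u_ f_ : nat -> l2,
  [/\ forall k, J0 (u_ k) (f_ k), l2_cvg u_ u & l2_cvg f_ f].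
Proof.
move=> [u_ [f_ [uf /ell2_cvg_l2[v_ [v [vE vu vv]]] /ell2_cvg_l2[g_ [g [gE gf gg]]]]]].
exists v_, g_; split.
- by move=> k; have := uf k; rewrite -vE -gE.
- by rewrite (_ : u = v)//; apply: l2_eqP => n; rewrite -vu.
- by rewrite (_ : f = g)//; apply: l2_eqP => n; rewrite -gf.
Qed.

Lemma jacobi_of_approx u f (u_ f_ : nat -> l2) :
  (forall k, J0 (u_ k) (f_ k)) -> l2_cvg u_ u -> l2_cvg f_ f -> J u f.
Proof.
move=> uf /ell2_cvgP uu /ell2_cvgP ff.
by exists (fun k => u_ k), (fun k => f_ k).
Qed.

Lemma jacobi_finite_jacobi u f : J0 u f -> J u f.
Proof.
move=> uf; apply: (@jacobi_of_approx _ _ (fun=> u) (fun=> f)) => //;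
exact: ip_cvg_cst ip_inner _.
Qed.

Lemma jacobi_ell2 (u f : nat -> R[i]) : J u f -> ell2 u /\ ell2 f.
Proof. by move=> [u_ [f_ [_ [_ ? _] [_ ? _]]]]. Qed.

Lemma jacobi_muli u f : J u f -> J (muli u) (muli f).
Proof.
move=> /jacobi_approx[u_ [f_ [uf uu ff]]].
apply: (@jacobi_of_approx _ _ (fun k => muli (u_ k)) (fun k => muli (f_ k))).
- by move=> k; exact: jacobi_finite_muli.
- by rewrite /ip_cvg; under eq_fun do rewrite -muliB ip_muli.
- by rewrite /ip_cvg; under eq_fun do rewrite -muliB ip_muli.
Qed.

Lemma jacobiD t u f v g : J u f -> J v g -> J (u + t *: v) (f + t *: g).
Proof.
move=> /jacobi_approx[u_ [f_ [uf uu ff]]] /jacobi_approx[v_ [g_ [vg vv gg]]].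
apply: (@jacobi_of_approx _ _ (fun k => u_ k + t *: v_ k) (fun k => f_ k + t *: g_ k)).
- by move=> k; exact: jacobi_finiteD.
- exact: (ip_cvgD ip_inner uu (ip_cvgZ ip_inner t vv)).
- exact: (ip_cvgD ip_inner ff (ip_cvgZ ip_inner t gg)).
Qed.

Lemma jacobiB u f v g : J u f -> J v g -> J (u - v) (f - g).
Proof. by rewrite -(scaleN1r v) -(scaleN1r g); exact: jacobiD. Qed.

Lemma jacobi_finite_sym u f v g : J0 u f -> J0 v g -> ip f v = ip u g.
Proof.
move=> [[N u0] fE] [_ gE]; rewrite /ip fE gE; exact: rdot_jacobi_action u0.
Qed.

Lemma jacobi_sym u f v g : J u f -> J v g -> ip f v = ip u g.
Proof.
move=> /jacobi_approx[u_ [f_ [uf uu ff]]] /jacobi_approx[v_ [g_ [vg vv gg]]].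
have := cvg_ip ip_inner ff vv; have := cvg_ip ip_inner uu gg.
have -> : (fun n => ip (f_ n) (v_ n)) = (fun n => ip (u_ n) (g_ n)).
  by apply/funext => n; exact: jacobi_finite_sym.
by move=> + /cvg_lim => /cvg_lim <-// <-.
Qed.

Lemma jacobi_ge0 u f : J u f -> 0 <= ip f u.
Proof. by move=> /J_pos; rewrite lecE Re_dot => /andP[]. Qed.

Lemma jacobi_cauchy_schwarz u f v g : J u f -> J v g ->
  ip f v ^+ 2 <= ip f u * ip g v.
Proof.
move=> uf vg; apply: discriminant_le0 => [|t]; first exact: jacobi_ge0.
have := jacobi_ge0 (jacobiD t uf vg).
rewrite !(ipE ip_inner) (jacobi_sym vg uf) (ipC v f) => /le_trans; apply.
by rewrite le_eqVlt; apply/predU1P; left; ring.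
Qed.

Lemma adjoint_jacobi u f : adjoint J u f ->
  forall x y, J x y -> ip y u = ip x f.
Proof. by move=> [_ _ uf] x y /uf/dot_eq[]. Qed.

(** Testing against the unit vector at [n] and against its multiple by i gives the real and
    imaginary parts of coordinate [n]. *)
Lemma adjoint_jacobi_action u f : adjoint J u f ->
  (f : nat -> R[i]) = jacobi_action a b u.
Proof.
move=> uf; apply/funext => n.
pose d (m : nat) : R[i] := (m == n)%:R.
have d0 m : (n.+1 <= m)%N -> d m = 0 by move=> nm; rewrite /d gtn_eqF.
have d2 := ell2_finite d0.
have Jd2 := ell2_finite (jacobi_action_finite d0).
have Jd : J0 (mkl2 d2) (mkl2 Jd2) by split => //; exists n.+1.
have dotd (v : nat -> R[i]) : rdot d v = Re (v n).
  rewrite (rdot_finite _ d0) big_ord_recr /= big1 ?add0r.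
    by rewrite /d eqxx mul1r mul0r addr0.
  by move=> m _; rewrite /d ltn_eqF//= !mul0r addr0.
have dotid (v : nat -> R[i]) : rdot (muli (mkl2 d2)) v = Im (v n).
  have id0 m : (n.+1 <= m)%N -> muli (mkl2 d2) m = 0.
    by move=> nm /=; rewrite d0// mulr0.
  rewrite (rdot_finite _ id0) big_ord_recr /= big1 ?add0r.
    by rewrite /d eqxx mulr1 /= mul0r mul1r add0r.
  by move=> m _; rewrite /d ltn_eqF// mulr0 /= !mul0r addr0.
apply/eqP; rewrite eq_complex; apply/andP; split; apply/eqP.
  have := adjoint_jacobi uf (jacobi_finite_jacobi Jd); rewrite /ip /= dotd => <-.
  by rewrite (rdot_jacobi_action _ d0) dotd.
have := adjoint_jacobi uf (jacobi_finite_jacobi (jacobi_finite_muli Jd)).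
rewrite {2}/ip dotid => <-; have [[N id0]] := jacobi_finite_muli Jd.
by rewrite /ip => ->; rewrite (rdot_jacobi_action _ id0) dotid.
Qed.

Lemma jacobi_adjoint u f : J u f -> adjoint J u f.
Proof.
move=> uf; split; [exact: l2P|exact: l2P|] => x y xy.
have [x2 y2] := jacobi_ell2 xy.
have {}xy : J (mkl2 x2) (mkl2 y2) by [].
by apply/(@dot_eq _ (mkl2 x2) (mkl2 y2)); split;
  apply: jacobi_sym => //; exact: jacobi_muli.
Qed.

(** * Extension of the quadratic form to the Friedrichs domain *)

Definition form_cauchy (u_ f_ : nat -> l2) := forall e : R, 0 < e ->
  exists N : nat, forall k l, (N <= k)%N -> (N <= l)%N ->
    ip (f_ k - f_ l) (u_ k - u_ l) < e.

Definition form_approx u (u_ f_ : nat -> l2) :=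
  [/\ forall k, J (u_ k) (f_ k), l2_cvg u_ u & form_cauchy u_ f_].

Lemma friedrichs_approx u f : A u f ->
  adjoint J u f /\ exists u_ f_ : nat -> l2, form_approx u u_ f_.
Proof.
move=> [uf [u_ [f_ [Juf uu cau]]]]; split => //.
have f2 k : ell2 (f_ k) := (jacobi_ell2 (Juf k)).2.
have [v_ [v [vE vu vv]]] := ell2_cvg_l2 uu.
exists v_, (fun k => mkl2 (f2 k)); split.
- by move=> k; have := Juf k; rewrite -vE.
- by rewrite (_ : u = v)//; apply: l2_eqP => n; rewrite -vu.
- by move=> e /cau[N NP]; exists N => k l Nk Nl; have := NP k l Nk Nl;
    rewrite -vE Re_dot.
Qed.

Lemma friedrichs_of_approx u f (u_ f_ : nat -> l2) :
  adjoint J u f -> form_approx u u_ f_ -> A u f.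
Proof.
move=> uf [Juf /ell2_cvgP uu cau]; split => //.
exists (fun k => u_ k), (fun k => f_ k); split => // e /cau[N NP].
by exists N => k l Nk Nl; rewrite Re_dot; exact: NP.
Qed.

Lemma jacobi_friedrichs u f : J u f -> A u f.
Proof.
move=> uf; apply: (@friedrichs_of_approx _ _ (fun=> u) (fun=> f)).
  exact: jacobi_adjoint.
split => //; first exact: ip_cvg_cst ip_inner _.
by move=> e e0; exists 0%N => k l _ _; rewrite !subrr (ip0l ip_inner).
Qed.

Lemma friedrichs_muli u f : A u f -> A (muli u) (muli f).
Proof.
move=> /friedrichs_approx[[_ _ uf] [u_ [f_ [Juf uu cau]]]].
apply: (@friedrichs_of_approx _ _ (fun k => muli (u_ k)) (fun k => muli (f_ k))).
  split; [exact: l2P|exact: l2P|] => x y xy.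
  have := uf _ _ xy; have [x2 y2] := jacobi_ell2 xy.
  move=> /(@dot_eq _ (mkl2 x2) (mkl2 y2))[E1 E2].
  apply/(@dot_eq _ (mkl2 x2) (mkl2 y2)); split => //.
  by rewrite !muliK !(ipNr ip_inner) E1.
split.
- by move=> k; exact: jacobi_muli.
- by rewrite /ip_cvg; under eq_fun do rewrite -muliB ip_muli.
- by move=> e /cau[N NP]; exists N => k l Nk Nl; rewrite -!muliB ip_muli NP.
Qed.

(** For the form [q], positivity at [u_k - 2 u_N] gives [q(u_k) <= 2 q(u_k - u_N) + 2 q(u_N)]. *)
Lemma form_cauchy_bounded (u_ f_ : nat -> l2) : (forall k, J (u_ k) (f_ k)) ->
  form_cauchy u_ f_ -> exists (C : R) (N : nat), 0 < C /\
    forall k, (N <= k)%N -> ip (f_ k) (u_ k) <= C.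
Proof.
move=> Juf /(_ 1 ltr01)[N NP]; exists (2 * ip (f_ N) (u_ N) + 2), N.
have q0 := jacobi_ge0 (Juf N).
split=> [|k Nk]; first by lra.
have := NP k N Nk (leqnn N).
have := jacobi_ge0 (jacobiB (jacobiB (Juf k) (Juf N)) (Juf N)).
rewrite !(ipE ip_inner).
have := jacobi_sym (Juf k) (Juf N); rewrite (ipC (u_ k)) => ->.
by move: q0; lra.
Qed.

(** The error [<f - f_k, w_k>] equals [<u - u_k, g_k>]. It is the limit over [l] of form products of
    [u_l - u_k] and [w_k], which Cauchy-Schwarz for the form makes small: the first factor is
    form-Cauchy and the second form-bounded. *)
Lemma form_approx_cvg u f (u_ f_ : nat -> l2) w (w_ g_ : nat -> l2) :
  adjoint J u f -> form_approx u u_ f_ -> form_approx w w_ g_ ->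
  ip (f_ k) (w_ k) @[k --> \oo] --> ip f w.
Proof.
move=> uf [Juf uu ucau] [Jwg ww wcau].
have [C [N0 [C0 gC]]] := form_cauchy_bounded Jwg wcau.
have r0 : (ip (u - u_ k) (g_ k)) @[k --> \oo] --> (0 : R).
  apply: (@cvg_sqr_le0 _ _ (fun k => ip (u - u_ k) (g_ k) ^+ 2)) => //.
  apply/cvgr0Pnorm_le => e e0.
  have [N NP] := ucau (e / C) (divr_gt0 e0 C0).
  exists (maxn N0 N) => // k /=; rewrite geq_max => /andP[N0k Nk].
  rewrite ger0_norm ?sqr_ge0//.
  have cvk : ip (u_ l - u_ k) (g_ k) ^+ 2 @[l --> \oo] --> ip (u - u_ k) (g_ k) ^+ 2.
    have c1 : ip (u_ l - u_ k) (g_ k) @[l --> \oo] --> ip (u - u_ k) (g_ k).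
      apply: (cvg_ip ip_inner); last exact: ip_cvg_cst ip_inner _.
      by apply: (ip_cvgB ip_inner) => //; exact: ip_cvg_cst ip_inner _.
    by rewrite expr2; under eq_fun do rewrite expr2; exact: cvgM.
  apply: (cvgr_to_le cvk); exists N => // l /= Nl.
  rewrite -(jacobi_sym (jacobiB (Juf l) (Juf k)) (Jwg k)).
  apply: le_trans (jacobi_cauchy_schwarz (jacobiB (Juf l) (Juf k)) (Jwg k)) _.
  rewrite -[leRHS](divfK (lt0r_neq0 C0)).
  apply: ler_pM; [exact: jacobi_ge0 (jacobiB (Juf l) (Juf k))|exact: jacobi_ge0|
    |exact: gC].
  exact/ltW/NP.
have fw0 : ip f (w_ k) @[k --> \oo] --> ip f w.
  by apply: (cvg_ip ip_inner) => //; exact: ip_cvg_cst ip_inner _.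
apply: (@cvg_eqr _ _ (ip f w - 0)); last by rewrite subr0.
suff -> : (fun k => ip (f_ k) (w_ k)) =
    (fun k => ip f (w_ k) - ip (u - u_ k) (g_ k)) by exact: cvgB.
apply/funext => k; rewrite (jacobi_sym (Juf k) (Jwg k)) !(ipE ip_inner).
by rewrite (ipC f) -(adjoint_jacobi uf (Jwg k)) (ipC (g_ k)); ring.
Qed.

Lemma friedrichs_sym u f w g : A u f -> A w g -> ip f w = ip u g.
Proof.
move=> /friedrichs_approx[uf [u_ [f_ uuff]]] /friedrichs_approx[wg [w_ [g_ wwgg]]].
have := form_approx_cvg uf uuff wwgg; have := form_approx_cvg wg wwgg uuff.
have [[Juf _ _] [Jwg _ _]] := (uuff, wwgg).
under eq_fun do rewrite (jacobi_sym (Jwg _) (Juf _)) ipC.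
by rewrite (ipC g) => + /cvg_lim => /cvg_lim <-// <-.
Qed.

Lemma friedrichs_ge0 u f : A u f -> 0 <= ip f u.
Proof.
move=> /friedrichs_approx[uf [u_ [f_ uuff]]].
apply: (cvgr_to_ge (form_approx_cvg uf uuff uuff)); apply: nearW => k.
by have [Juf _ _] := uuff; exact: jacobi_ge0.
Qed.

Lemma friedrichs_action u f : A u f -> (f : nat -> R[i]) = jacobi_action a b u.
Proof. by move=> [/adjoint_jacobi_action]. Qed.

(** Finitely supported vectors are a form core: a diagonal choice replaces each vector of the domain
    of [J] by one close to it both in norm and in the value of the form. *)
Lemma friedrichs_finite_approx u f : A u f -> exists u_ f_ : nat -> l2,
  [/\ forall k, J0 (u_ k) (f_ k), l2_cvg u_ u &
      ip (f_ k) (u_ k) @[k --> \oo] --> ip f u].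
Proof.
move=> /friedrichs_approx[uf [u_ [f_ uuff]]].
have [Juf uu _] := uuff.
have /choice[p pP] : forall k, exists p : l2 * l2, [/\ J0 p.1 p.2,
    ip (p.1 - u_ k) (p.1 - u_ k) <= k.+1%:R^-1 &
    (ip p.2 p.1 - ip (f_ k) (u_ k)) ^+ 2 <= k.+1%:R^-1].
  move=> k; have [v_ [g_ [vg vv gg]]] := jacobi_approx (Juf k).
  have k0 : (0 : R) < k.+1%:R^-1 by rewrite invr_gt0.
  move/cvgr_lt : (vv) => /(_ _ k0)[N _ NP].
  have : (ip (g_ n) (v_ n) - ip (f_ k) (u_ k)) ^+ 2 @[n --> \oo] --> (0 : R).
    apply: cvg_eqr; last by rewrite -(mulr0 0).
    have c0 : ip (g_ n) (v_ n) - ip (f_ k) (u_ k) @[n --> \oo] --> (0 : R).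
      by apply/subr_cvg0; exact: (cvg_ip ip_inner gg vv).
    by under eq_fun do rewrite expr2; exact: cvgM.
  move/cvgr_lt => /(_ _ k0)[M _ MP].
  exists (v_ (maxn N M), g_ (maxn N M)); split => //=.
    by apply/ltW/NP; exact: leq_maxl.
  by apply/ltW/MP; exact: leq_maxr.
exists (fun k => (p k).1), (fun k => (p k).2); split.
- by move=> k; have [] := pP k.
- have pu : l2_cvg (fun k => (p k).1 - u_ k) 0.
    apply: (@squeeze_cvgr _ _ _ _ (fun=> 0) (fun k => k.+1%:R^-1)).
    + by near=> k; rewrite ip_ge0/= subr0; have [] := pP k.
    + exact: cvg_cst.
    + exact: cvg_harmonic.
  have := ip_cvgD ip_inner pu uu; rewrite add0r.
  by under eq_fun do rewrite subrK.
- have d0 : ip (p k).2 (p k).1 - ip (f_ k) (u_ k) @[k --> \oo] --> (0 : R).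
    apply: (cvg_sqr_le0 _ (@cvg_harmonic R)) => k.
    by have [] := pP k.
  apply: cvg_eqr; last exact: add0r.
  have -> : (fun k => ip (p k).2 (p k).1) = (fun k =>
      ip (p k).2 (p k).1 - ip (f_ k) (u_ k) + ip (f_ k) (u_ k)).
    by apply/funext => k; rewrite subrK.
  exact: cvgD d0 (form_approx_cvg uf uuff uuff).
Unshelve. all: by end_near. Qed.

End jacobi_operator.

(** * Spectrum of the Friedrichs extension *)

Section friedrichs_spectrum.
Context {R : realType} (a b : nat -> R).
Hypothesis a_gt0 : forall n, 0 < a n.
Hypothesis J_pos : positive_operator (jacobi a b).
Hypothesis JF_inv_compact :
  compact_operator (op_inverse (friedrichs (jacobi a b))).
Local Notation Re := (@complex.Re R).
Local Notation Im := (@complex.Im R).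
Local Notation l2 := (l2 R).
Local Notation l2_cvg := (ip_cvg (ip := @ip R)).
Local Notation A := (friedrichs (jacobi a b)).
Implicit Types u v w f g h e : l2.

(** The inverse of the Friedrichs extension as a function; eigenvectors for [z] are then written
    [u = z *: K u], with no domain condition. *)
Definition friedrichs_solution (K : l2 -> l2) : Prop :=
  (forall f, A (K f) f) /\ (forall u f, A u f -> u = K f).

Lemma friedrichs_ell2 (u f : nat -> R[i]) : A u f -> ell2 u /\ ell2 f.
Proof. by move=> [[? ? _] _]. Qed.

Lemma exists_friedrichs_solution : exists K, friedrichs_solution K.
Proof.
have [def _] := JF_inv_compact.
have /choice[K KP] : forall f, exists u, A u f /\ forall v, A v f -> v = u.
  move=> f; have [u [uf u_uniq]] := def _ (l2P f).
  have [u2 _] := friedrichs_ell2 uf; exists (mkl2 u2); split => // v vf.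
  by apply: l2_eqP => n /=; rewrite (u_uniq _ vf).
by exists K; split=> [f|u f]; have [? ?] := KP f; auto.
Qed.

Section solution_operator.
Variable K : l2 -> l2.
Hypothesis KP : friedrichs_solution K.

Lemma solution_sym f g : ip (K f) g = ip f (K g).
Proof. by rewrite (friedrichs_sym J_pos (KP.1 f) (KP.1 g)). Qed.

Lemma solution_ge0 f : 0 <= ip (K f) f.
Proof. by rewrite ipC (friedrichs_ge0 J_pos (KP.1 f)). Qed.

Lemma solution_compact : ip_compact (ip := @ip R) K.
Proof.
move=> u_ M uM; have [_ comp] := JF_inv_compact.
have [|phi [v [incr /ell2_cvg_l2[w_ [w [wE _ ww]]]]]] :=
    comp (fun k => u_ k) (fun k => K (u_ k)) (Num.sqrt M).
  move=> k; split; [exact: l2P| |exact: KP.1].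
  by rewrite ell2_norm_l2 ler_wsqrtr.
exists phi, w; split; first exact: incr.
suff -> : K \o u_ \o phi = w_ by exact: ww.
apply/funext => k; apply: l2_eqP => n.
by have := congr1 (fun s : nat -> nat -> R[i] => s k n) wE.
Qed.

Lemma solution_eq0 f : K f = 0 -> f = 0.
Proof.
move=> Kf0; have := KP.1 f; rewrite Kf0 => /friedrichs_action fE.
apply: l2_eqP => n; rewrite fE /jacobi_action.
by case: n => [|n]; rewrite !mulr0 !addr0.
Qed.

Lemma solution_eigenP (z : R) u : u = z *: K u <-> A u (z *: u : l2).
Proof.
have KZ := symZ ip_inner solution_sym; split=> [uE|/(KP.2)].
  by have := KP.1 (z *: u); rewrite KZ -uE.
by rewrite KZ.
Qed.

(** Both 0 and the eigenvector are preimages of 0 under the shifted operator, so its inverse is not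
    single-valued. *)
Lemma eigenvalue_spectrum (z : R) u : u != 0 -> u = z *: K u ->
  spectrum A z%:C.
Proof.
move=> u0 /solution_eigenP Au [def _].
have A0 : A (0 : l2) (0 : l2).
  by have := KP.1 0; rewrite (sym0 ip_inner solution_sym).
have [v [_ v_uniq]] := def _ (l2P (0 : l2)).
have v0 : v = (0 : l2).
  apply: v_uniq; exists (0 : l2) => //.
  by apply/funext => n; rewrite mulr0 subr0.
have vu : v = u.
  apply: v_uniq; exists (z *: u : l2) => //.
  apply/funext => n; rewrite l2Z; case: (u n) => p q.
  by apply/eqP; rewrite eq_complex /= /scalec /=; apply/andP; split; apply/eqP; ring.
by move/eqP: u0; apply; apply: l2_eqP => n; rewrite -vu v0.
Qed.

(** If [z] is not an eigenvalue, the Fredholm alternative solves [v - z K v = K f] uniquely and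
    boundedly, and this equation is equivalent to [(J_F - z) v = f]. *)
Lemma spectrum_eigenvalue (z : R) : spectrum A z%:C ->
  exists2 u, u != 0 & u = z *: K u.
Proof.
move=> spec; apply: contrapT => no_eigen; apply: spec.
have not_eigen u : u = z *: K u -> u = 0.
  by move=> uE; apply: contrapT => /eqP u0; apply: no_eigen; exists u.
have surj := fredholm_surjective ip_inner solution_sym solution_compact
  l2_complete not_eigen.
have [c c0 below] := fredholm_bounded_below ip_inner solution_sym
  solution_compact not_eigen.
have [M M0 KM] := compact_bounded ip_inner solution_sym solution_compact.
have KD := symD ip_inner solution_sym.
have KZ := symZ ip_inner solution_sym.
have KB := symB ip_inner solution_sym.
have shiftE v w f : A v w -> (f : nat -> R[i]) = (fun n => w n - z%:C * v n) ->
    w = f + z *: v.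
  move=> _ fE; apply: l2_eqP => n; rewrite l2D l2Z fE.
  case: (v n) (w n) => [p q] [r t].
  by apply/eqP; rewrite eq_complex /=; apply/andP; split; apply/eqP; ring.
have solve v f : op_inverse (op_shift A z%:C) f v -> v - z *: K v = K f.
  move=> [w vw fE].
  have [_ w2] := friedrichs_ell2 vw.
  have {}vw : A v (mkl2 w2) by [].
  have wE := shiftE v (mkl2 w2) f vw fE.
  by rewrite {1}(KP.2 _ _ vw) wE KD KZ addrK.
have ell2_solve (v f : nat -> R[i]) : op_inverse (op_shift A z%:C) f v -> ell2 v.
  by move=> [w vw _]; have [] := friedrichs_ell2 vw.
split.
  move=> f f2; have [v vE] := surj (K (mkl2 f2)); exists v; split.
    exists (mkl2 f2 + z *: v : l2).
      have := KP.1 (mkl2 f2 + z *: v); rewrite KD KZ.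
      by rewrite -vE subrK.
    apply/funext => n; rewrite l2D l2Z /=; case: (f n) (v n) => [p q] [r t].
    by apply/eqP; rewrite eq_complex /=; apply/andP; split; apply/eqP; ring.
  move=> v' fv'; have v'2 := ell2_solve _ _ fv'.
  have v'E := solve (mkl2 v'2) (mkl2 f2) fv'.
  suff : v - mkl2 v'2 = 0.
    by move=> /eqP; rewrite subr_eq0 => /eqP ->.
  apply: not_eigen; apply/eqP; rewrite -subr_eq0 KB scalerBr opprD opprK addrACA.
  by rewrite vE [X in _ + X]addrC -opprB v'E subrr.
(* The constant comes from [c |v|^2 <= |v - z K v|^2 = |K f|^2 <= M |f|^2]. *)
exists (Num.sqrt (M / c)) => f v fv.
have [w vw fE] := fv; have v2 := ell2_solve _ _ fv.
have [_ w2] := friedrichs_ell2 vw.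
have f2 : ell2 f.
  have -> : f = (mkl2 w2 - z *: mkl2 v2 : l2).
    rewrite fE; apply/funext => n; rewrite l2B l2Z /=.
    case: (v n) (w n) => [p q] [r t].
    by apply/eqP; rewrite eq_complex /=; apply/andP; split; apply/eqP; ring.
  exact: l2P.
have vE := solve (mkl2 v2) (mkl2 f2) fv.
have := ell2_norm_l2 (mkl2 v2); have := ell2_norm_l2 (mkl2 f2) => /= -> ->.
rewrite -sqrtrM ?divr_ge0 ?(ltW M0) ?(ltW c0)//.
apply: ler_wsqrtr; rewrite mulrAC ler_pdivlMr// mulrC.
by apply: le_trans (below _) _; rewrite vE.
Qed.

Lemma eigenvector_coord (z : R) u : u = z *: K u -> forall n,
  Re (u n) = Re (u 0%N) * orthonormal_poly a b n z /\
  Im (u n) = Im (u 0%N) * orthonormal_poly a b n z.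
Proof.
move=> /solution_eigenP/friedrichs_action uE n; split.
  apply: (@jacobi_real_eigenE _ a b a_gt0 z (fun m => Re (u m))) => m.
  by rewrite -[LHS]Re_jacobi_action -uE l2Z; case: (u m).
apply: (@jacobi_real_eigenE _ a b a_gt0 z (fun m => Im (u m))) => m.
by rewrite -[LHS]Im_jacobi_action -uE l2Z; case: (u m).
Qed.

Lemma eigenvector_muli (z : R) u : u = z *: K u -> muli u = z *: K (muli u).
Proof.
move=> /solution_eigenP Au; apply/solution_eigenP.
by rewrite -muliZ; exact: friedrichs_muli.
Qed.

End solution_operator.
End friedrichs_spectrum.

(** * Zeros and eigenvalues *)

Lemma sum_ord_support (R : realType) (s : nat -> R) N n : (N <= n)%N ->
  (forall m, (N <= m)%N -> s m = 0) -> \sum_(m < n) s m = \sum_(m < N) s m.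
Proof.
move=> Nn s0; rewrite (big_ord_widen _ s Nn) [LHS]big_mkcond [RHS]big_mkcond.
by apply: eq_bigr => m _ /=; case: ltnP => // /s0.
Qed.

Section eigenvalue_comparison.
Context {R : realType} (a b : nat -> R).
Hypothesis a_gt0 : forall n, 0 < a n.
Hypothesis J_pos : positive_operator (jacobi a b).
Hypothesis JF_inv_compact :
  compact_operator (op_inverse (friedrichs (jacobi a b))).
Variable zeta : nat -> R.
Hypothesis zeta_gt0 : 0 < zeta 1%N.
Hypothesis zeta_incr : forall j : nat, (1 <= j)%N -> zeta j < zeta j.+1.
Hypothesis zeta_spectrum : spectrum (friedrichs (jacobi a b)) =
  [set (zeta j)%:C | j in [set j : nat | (1 <= j)%N]].
Variable x : nat -> nat -> R.
Hypothesis x_incr : forall n i j : nat,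
  (1 <= i)%N -> (i < j)%N -> (j <= n)%N -> x i n < x j n.
Hypothesis x_zeros : forall n : nat, (1 <= n)%N ->
  [set t : R | root (ortho_poly a b n) t] =
  [set x j n | j in [set j : nat | (1 <= j <= n)%N]].
Local Notation Re := (@complex.Re R).
Local Notation Im := (@complex.Im R).
Local Notation l2 := (l2 R).
Local Notation l2_cvg := (ip_cvg (ip := @ip R)).
Local Notation J0 := (jacobi_finite a b).
Local Notation A := (friedrichs (jacobi a b)).
Local Notation P := (orthonormal_poly a b).
Variable K : l2 -> l2.
Hypothesis KP : friedrichs_solution a b K.
Implicit Types u v w f g h e : l2.

Let K_sym := solution_sym J_pos KP.
Let K_ge0 := solution_ge0 J_pos KP.
Let K_compact := solution_compact JF_inv_compact KP.

Lemma zeta_lt i j : (1 <= i)%N -> (i < j)%N -> zeta i < zeta j.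
Proof.
move=> i1; elim: j => // j IH; rewrite ltnS leq_eqVlt => /predU1P[<-|ij].
  exact: zeta_incr.
by apply: lt_trans (IH ij) (zeta_incr _); exact: leq_trans i1 (ltnW ij).
Qed.

Lemma zeta_pos j : (1 <= j)%N -> 0 < zeta j.
Proof.
rewrite leq_eqVlt => /predU1P[<-//|j1].
exact: lt_trans zeta_gt0 (zeta_lt _ j1).
Qed.

(** The eigenspaces are stable under multiplication by i, so real orthogonality to this set is
    complex orthogonality. *)
Definition eigenvectors_below (j : nat) : set l2 :=
  [set e | exists2 i, (1 <= i < j)%N & e = zeta i *: K e].

Lemma eigenvectors_below_K j e : eigenvectors_below j e -> exists c, K e = c *: e.
Proof.
move=> [i /andP[i1 _] eE]; exists (zeta i)^-1.
by rewrite [in RHS]eE scalerA mulVf ?scale1r// gt_eqF// zeta_pos.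
Qed.

Lemma K_orthogonal j f : (forall e, eigenvectors_below j e -> ip f e = 0) ->
  forall e, eigenvectors_below j e -> ip (K f) e = 0.
Proof.
move=> fE e Ee; have [c Kc] := eigenvectors_below_K Ee.
by rewrite K_sym Kc (ipZr ip_inner) fE// mulr0.
Qed.

(** Otherwise [K] has an eigenvector, orthogonal to [eigenvectors_below j], with eigenvalue [mu]
    above the inverse of [zeta j]. Then [mu^-1] is some [zeta k] with [k < j], so this eigenvector
    is orthogonal to itself. *)
Lemma solution_form_le j h : (1 <= j)%N ->
  (forall e, eigenvectors_below j e -> ip h e = 0) ->
  ip (K h) h <= (zeta j)^-1 * ip h h.
Proof.
move=> j1 hE; have zj := zeta_pos j1; rewrite leNgt; apply/negP => hj.
have [|mu [g [mu_lt g0 Kg gE]]] := compact_top_eigenvector ip_inner K_sym K_ge0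
    K_compact (@eigenvectors_below_K j) _ hE hj.
  by rewrite invr_gt0.
have mu0 : 0 < mu by apply: lt_trans mu_lt; rewrite invr_gt0.
have gK : g = mu^-1 *: K g by rewrite Kg scalerA mulVf ?scale1r// gt_eqF.
have := eigenvalue_spectrum J_pos KP g0 gK; rewrite zeta_spectrum.
move=> [k /= k1 [zk]].
have kj : (k < j)%N.
  rewrite ltnNge; apply/negP => jk.
  have : zeta j <= zeta k.
    by move: jk; rewrite leq_eqVlt => /predU1P[->//|/(zeta_lt j1)/ltW].
  by rewrite zk -[leLHS]invrK lef_pV2 ?posrE ?invr_gt0// leNgt mu_lt.
move/eqP: g0; apply; apply: ip_eq0; apply: gE.
by exists k; rewrite ?k1// zk.
Qed.

(* For [g = f - zeta_j u], expanding gives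
   [0 <= ip (K g) g <= ip f u - zeta_j ip u u]. *)
Lemma rayleigh_equality j u f : (1 <= j)%N -> A u f ->
  (forall e, eigenvectors_below j e -> ip u e = 0) ->
  ip f u <= zeta j * ip u u -> f = zeta j *: u.
Proof.
move=> j1 uf uE fu; have zj := zeta_pos j1.
have uK := KP.2 _ _ uf.
have fE e : eigenvectors_below j e -> ip f e = 0.
  move=> Ee; have [i _ eE] := Ee.
  by rewrite eE (ipZr ip_inner) -K_sym -uK uE// mulr0.
pose g := f - zeta j *: u.
have gE e : eigenvectors_below j e -> ip g e = 0.
  by move=> Ee; rewrite !(ipE ip_inner) fE// uE// mulr0 subr0.
have Kgg : ip (K g) g = 0.
  apply/eqP; rewrite eq_le K_ge0 andbT.
  have := solution_form_le j1 uE.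
  rewrite (symB ip_inner K_sym) (symZ ip_inner K_sym) -uK !(ipE ip_inner).
  have -> : ip (K u) f = ip u u by rewrite K_sym -uK.
  rewrite (ipC u f) mulrC ler_pdivlMr// => uu.
  have := ler_wpM2l (ltW zj) uu.
  by move: fu; nra.
(* For a nonnegative operator with this upper bound, a vanishing form value at [g] forces
   [K g = 0]. *)
have Kg0 : K g = 0.
  apply: ip_eq0; apply/eqP; rewrite eq_le ip_ge0 andbT.
  have := sym_ge0_norm_le ip_inner K_sym K_ge0
    (solution_form_le j1 (K_orthogonal gE)).
  by rewrite Kgg mulr0.
by apply/eqP; rewrite -subr_eq0; apply/eqP; exact: (solution_eq0 KP).
Qed.

(** * The strict lower bound for the zeros *)

Section zeros.
Variable n : nat.
Hypothesis n_gt0 : (1 <= n)%N.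

Let xx (i : 'I_n) := x i.+1 n.

Lemma zeros_inj : injective xx.
Proof.
move=> i j /eqP; apply: contraTeq => ij; rewrite neq_lt.
move: ij; rewrite neq_ltn => /orP[] ij; first by rewrite x_incr.
by rewrite [X in _ || X]x_incr ?orbT.
Qed.

Lemma zeros_root i : P n (xx i) = 0.
Proof.
apply: root_orthonormal_poly.
suff : [set t : R | root (ortho_poly a b n) t] (xx i) by [].
by rewrite x_zeros//; exists i.+1 => //=; exact: ltn_ord.
Qed.

Lemma zeros_le i j : (i <= j)%N -> (j < n)%N -> x i.+1 n <= x j.+1 n.
Proof.
by rewrite leq_eqVlt => /predU1P[->//|ij] jn; rewrite ltW// x_incr.
Qed.

(** For real [u] only the real part of [e] enters, and it is a multiple of the sequence [P m z]. *)
Lemma ip_real_eigenvector (z : R) (c : nat -> R) u e : e = z *: K e ->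
  (forall m, (n <= m)%N -> c m = 0) -> (forall m, u m = (c m)%:C) ->
  \sum_(m < n) c m * P m z = 0 -> ip u e = 0.
Proof.
move=> eE c0 uE cP; rewrite /ip (@rdot_finite R u e n); last first.
  by move=> m nm; rewrite uE c0.
rewrite -[RHS](mulr0 (Re (e 0%N))) -[in RHS]cP mulr_sumr; apply: eq_bigr => m _.
have [eR _] := eigenvector_coord a_gt0 J_pos KP eE m.
by rewrite uE /= mul0r addr0 eR mulrCA.
Qed.

Lemma zeta_lt_zeros j : (1 <= j <= n)%N -> zeta j < x j n.
Proof.
move=> /andP[j1 jn]; rewrite ltNge; apply/negP => xz.
(* The [j.-1] eigenvalues before [zeta j] and the [n - j] zeros after [x j n] impose only [n.-1]
   conditions on [n] coefficients, so the left kernel is nonzero. *)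
pose B : 'M[R]_(n, n.-1) := \matrix_(m, k)
  if (k < j.-1)%N then P m (zeta k.+1) else P m (x k.+2 n).
pose c_ := nz_row (kermx B).
have c_n0 : c_ != 0.
  rewrite nz_row_eq0 -mxrank_eq0 mxrank_ker subn_eq0 -ltnNge.
  by apply: leq_ltn_trans (rank_leq_col _) _; rewrite prednK.
have cB k : (c_ *m B) 0 k = 0.
  have /sub_kermxP -> : (c_ <= kermx B)%MS by exact: nz_row_sub.
  by rewrite mxE.
pose c m := if insub m is Some i then c_ 0 i else 0.
have cE (m : 'I_n) : c m = c_ 0 m by rewrite /c valK.
have c0 m : (n <= m)%N -> c m = 0.
  by move=> nm; rewrite /c insubF// ltnNge nm.
have cz i : (1 <= i < j)%N -> \sum_(m < n) c m * P m (zeta i) = 0.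
  case: i => // i /= ij; have ki : (i < n.-1)%N by lia.
  rewrite -[RHS](cB (Ordinal ki)) mxE.
  by apply: eq_bigr => m _; rewrite mxE /= cE ifT//; lia.
have cx (i : 'I_n) : (j <= i)%N -> \sum_(m < n) c m * P m (xx i) = 0.
  move=> ji; have ki : (i.-1 < n.-1)%N by have := ltn_ord i; lia.
  rewrite -[RHS](cB (Ordinal ki)) mxE.
  apply: eq_bigr => m _; rewrite mxE /= cE ifF; last by lia.
  by rewrite /xx (_ : i.-1.+2 = i.+1)//; lia.
have u0 m : (n <= m)%N -> (c m)%:C = 0 :> R[i] by move=> nm; rewrite c0.
pose u := mkl2 (ell2_finite u0).
pose f := mkl2 (ell2_finite (jacobi_action_finite a b u0)).
have J0u : J0 u f by split => //; exists n.
have Au := jacobi_friedrichs (jacobi_finite_jacobi J0u).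
have fE m : Re (f m) = jacobi_real a b c m.
  exact: (Re_jacobi_action a b (fun m => (c m)%:C)).
(* The transform vanishes at the nodes after the [j]th, and the other nodes are at most
   [x j n <= zeta j]. *)
have fu : ip f u <= zeta j * ip u u.
  rewrite ipC /ip !(rdot_finite _ u0).
  under eq_bigr do rewrite fE /= mul0r addr0 mulrC.
  under [X in _ <= _ * X]eq_bigr do rewrite /= mul0r addr0.
  rewrite (gauss_energy a_gt0 zeros_inj zeros_root c0).
  rewrite (gauss_parseval a_gt0 zeros_inj zeros_root) mulr_sumr.
  apply: ler_sum => i _; have w0 := gauss_weight_gt0 a b xx i.
  have [ji|ij] := leqP j i; first by rewrite cx// expr0n !mulr0.
  have xi : xx i <= zeta j.
    apply: le_trans xz; have := @zeros_le i j.-1; rewrite prednK//.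
    by apply; lia.
  set Q := \sum_(m < n) _; set w := gauss_weight _ _ _ _ in w0 *.
  rewrite -subr_ge0 (_ : _ - _ = w * Q ^+ 2 * (zeta j - xx i)); last by ring.
  by rewrite mulr_ge0 ?subr_ge0// mulr_ge0 ?sqr_ge0// ltW.
have uE e : eigenvectors_below j e -> ip u e = 0.
  by move=> [i ij eE]; apply: (ip_real_eigenvector eE c0) => //; exact: cz.
(* The equality case makes the finitely supported [u] an eigenvector, hence 0. *)
have := rayleigh_equality j1 Au uE fu => fzu.
have c_eigen m : jacobi_real a b c m = zeta j * c m.
  by rewrite -fE fzu l2Z.
move/eqP: c_n0; apply; apply/rowP => m; rewrite mxE -cE.
exact: (jacobi_real_finite_eigen a_gt0 c_eigen c0).
Qed.

(** Termwise in the quadrature: for [i < k] the left term is nonpositive as the weight is at most 1,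
    and the right one nonnegative as the zeros are positive; for the other [i] the zeros are
    ordered. *)
Lemma zeros_form_bound (c : nat -> R) (k : nat) : (k < n)%N ->
  (forall m, (n <= m)%N -> c m = 0) ->
  x k.+1 n * (\sum_(m < n) c m ^+ 2 -
    \sum_(i < k) (\sum_(m < n) c m * P m (x i.+1 n)) ^+ 2) <=
  \sum_(m < n) jacobi_real a b c m * c m.
Proof.
move=> kn c0; pose q i := (\sum_(m < n) c m * P m (x i.+1 n)) ^+ 2.
have q0 i : 0 <= q i by exact: sqr_ge0.
have x0 i : (i < n)%N -> 0 < x i.+1 n.
  by move=> ni; apply: lt_trans (zeta_lt_zeros _); [exact: zeta_pos|].
rewrite (gauss_energy a_gt0 zeros_inj zeros_root c0).
under eq_bigr do rewrite expr2.
rewrite (gauss_parseval a_gt0 zeros_inj zeros_root).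
rewrite (big_ord_widen _ q (ltnW kn)) [X in _ - X]big_mkcond -sumrB mulr_sumr.
apply: ler_sum => i _; have xi0 := x0 _ (ltn_ord i); have xk0 := x0 _ kn.
have w0 := gauss_weight_gt0 a b xx i; have w1 := gauss_weight_le1 a b xx i.
rewrite -mulrA -expr2 -/(q i); set w := gauss_weight _ _ _ _ in w0 w1 *.
have [ik|ki] := ltnP i k.
  apply: (@le_trans _ _ 0); last exact: mulr_ge0 (mulr_ge0 (ltW w0) (ltW xi0)) (q0 i).
  by rewrite pmulr_rle0// subr_le0 ler_piMl.
rewrite subr0 mulrA [x _ _ * w]mulrC ler_wpM2r// ler_pM2l//.
by apply: zeros_le.
Qed.

End zeros.

(** * Convergence of the zeros *)

Lemma orthonormal_poly_continuous m : continuous (P m).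
Proof.
by move=> z; apply: cvgMr_tmp; exact: continuous_horner.
Qed.

Lemma eigenvectors_orthogonal (y z : R) u w : y != z ->
  u = y *: K u -> w = z *: K w -> ip u w = 0.
Proof.
move=> yz uE wE; have E1 : ip u w = y * ip (K u) w.
  by rewrite [in LHS]uE (ipZl y (K u) w).
have E2 : ip u w = z * ip (K u) w.
  by rewrite [in LHS]wE (ipZr ip_inner) K_sym.
apply/eqP; rewrite E1 mulf_eq0; apply/orP; right.
have /eqP : (y - z) * ip (K u) w = 0 by rewrite mulrBl -E1 -E2 subrr.
by rewrite mulf_eq0 subr_eq0 (negPf yz).
Qed.

(* For real [z], the squared modulus of [\sum_(m < N) u m * P m z]. *)
Definition transform_sqr (N : nat) u (z : R) : R :=
  (\sum_(m < N) Re (u m) * P m z) ^+ 2 + (\sum_(m < N) Im (u m) * P m z) ^+ 2.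

(* The eigenspace is stable under multiplication by i, and the two real inner
   products with [w] and [i w] together control the complex one. *)
Lemma transform_sqr_eigen (N : nat) u w (z : R) :
  (forall m, (N <= m)%N -> u m = 0) -> w = z *: K w ->
  (Re (w 0%N) ^+ 2 + Im (w 0%N) ^+ 2) * transform_sqr N u z =
  ip u w ^+ 2 + ip u (muli w) ^+ 2.
Proof.
move=> u0 wE; rewrite /ip !(rdot_finite _ u0) !big_split /=.
have wR m := (eigenvector_coord a_gt0 J_pos KP wE m).1.
have wI m := (eigenvector_coord a_gt0 J_pos KP wE m).2.
have iwR m : Re ('i * w m) = - Im (w m) by case: (w m) => p q /=; ring.
have iwI m : Im ('i * w m) = Re (w m) by case: (w m) => p q /=; ring.
under [in RHS]eq_bigr do rewrite wR mulrCA.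
under [X in (_ + X) ^+ 2 + _]eq_bigr do rewrite wI mulrCA.
under [X in _ + (X + _) ^+ 2]eq_bigr do rewrite iwR wI mulrN mulrCA.
under [X in _ + (_ + X) ^+ 2]eq_bigr do rewrite iwI wR mulrCA.
rewrite sumrN -!mulr_sumr /transform_sqr.
by ring.
Qed.

Lemma eigenvector_head_neq0 u (z : R) : u != 0 -> u = z *: K u ->
  0 < Re (u 0%N) ^+ 2 + Im (u 0%N) ^+ 2.
Proof.
move=> u0 uE; rewrite lt0r addr_ge0 ?sqr_ge0// andbT.
apply: contra_neq u0 => /eqP; rewrite paddr_eq0 ?sqr_ge0// !sqrf_eq0.
move=> /andP[/eqP R0 /eqP I0]; apply: l2_eqP => n.
have [] := eigenvector_coord a_gt0 J_pos KP uE n; rewrite R0 I0 !mul0r.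
by case: (u n) => p q /= -> ->.
Qed.

Lemma ip_finite_energy u f n : J0 u f -> (forall m, (n <= m)%N -> u m = 0) ->
  ip f u = \sum_(m < n) jacobi_real a b (Re \o u) m * Re (u m) +
           \sum_(m < n) jacobi_real a b (Im \o u) m * Im (u m).
Proof.
move=> [_ fE] u0; rewrite ipC /ip (rdot_finite _ u0) big_split /=; congr (_ + _).
  by apply: eq_bigr => m _; rewrite fE Re_jacobi_action mulrC.
by apply: eq_bigr => m _; rewrite fE Im_jacobi_action mulrC.
Qed.

(** The real and imaginary parts are bounded separately. The transforms are cut at the support bound
    [N] instead of [n], so [n] can tend to infinity with [u] fixed. *)
Lemma zeros_transform_bound u f (N n k : nat) : J0 u f ->
  (forall m, (N <= m)%N -> u m = 0) -> (N <= n)%N -> (k < n)%N ->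
  x k.+1 n * (ip u u - \sum_(i < k) transform_sqr N u (x i.+1 n)) <= ip f u.
Proof.
move=> uf u0 Nn kn; have n0 : (1 <= n)%N := leq_ltn_trans (leq0n k) kn.
have un m : (n <= m)%N -> u m = 0 by move=> nm; apply: u0; exact: leq_trans nm.
have cR m : (n <= m)%N -> (Re \o u) m = 0 by move=> nm /=; rewrite un.
have cI m : (n <= m)%N -> (Im \o u) m = 0 by move=> nm /=; rewrite un.
rewrite (ip_finite_energy uf un).
apply: le_trans (lerD (zeros_form_bound n0 kn cR) (zeros_form_bound n0 kn cI)).
rewrite -mulrDr /ip (rdot_finite _ un) big_split /= addrACA -opprD.
rewrite le_eqVlt; apply/predU1P; left; congr (_ * (_ - _)).
rewrite -big_split /=; apply: eq_bigr => i _; rewrite /transform_sqr.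
have support (F : R[i] -> R) : F 0 = 0 ->
    \sum_(m < N) F (u m) * P m (x i.+1 n) = \sum_(m < n) F (u m) * P m (x i.+1 n).
  move=> F0; apply/esym.
  apply: (@sum_ord_support _ (fun m => F (u m) * P m _) N n Nn) => m Nm.
  by rewrite u0// F0 mul0r.
by rewrite (support Re)// (support Im).
Qed.

Lemma zeros_cvg j : (1 <= j)%N -> x j n @[n --> \oo] --> zeta j.
Proof.
case: j => // k _; elim/ltn_ind: k => k IH.
have [u u0 uE] : exists2 u, u != 0 & u = zeta k.+1 *: K u.
  apply: (spectrum_eigenvalue J_pos JF_inv_compact KP).
  by rewrite zeta_spectrum; exists k.+1.
have Au : A u (zeta k.+1 *: u : l2) by apply/(solution_eigenP J_pos KP).
have [u_ [f_ [uf uu fu]]] := friedrichs_finite_approx J_pos Au.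
have /choice[N NP] : forall m, exists N, forall l, (N <= l)%N -> u_ m l = 0.
  by move=> m; have [] := uf m.
(* Up to the positive factor [h], the transform is a sum of squared inner products with eigenvectors
   for [zeta i.+1], to which [u] is orthogonal. *)
have T0 (i : 'I_k) : transform_sqr (N m) (u_ m) (zeta i.+1) @[m --> \oo] --> (0 : R).
  have [w w0 wE] : exists2 w, w != 0 & w = zeta i.+1 *: K w.
    apply: (spectrum_eigenvalue J_pos JF_inv_compact KP).
    by rewrite zeta_spectrum; exists i.+1.
  have h0 := eigenvector_head_neq0 w0 wE; set h := (X in 0 < X) in h0.
  have -> : (fun m => transform_sqr (N m) (u_ m) (zeta i.+1)) =
      (fun m => h^-1 * (ip (u_ m) w ^+ 2 + ip (u_ m) (muli w) ^+ 2)).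
    apply/funext => m; rewrite -(transform_sqr_eigen (NP m) wE) -/h.
    by rewrite mulKf// gt_eqF.
  have orth v : v = zeta i.+1 *: K v -> ip (u_ m) v ^+ 2 @[m --> \oo] --> (0 : R).
    move=> vE; have uv : ip (u_ m) v @[m --> \oo] --> (0 : R).
      have uv0 : ip u v = 0.
        by apply: eigenvectors_orthogonal uE vE; rewrite gt_eqF// zeta_lt//= ltnS.
      rewrite -uv0; apply: (cvg_ip ip_inner uu); exact: ip_cvg_cst ip_inner _.
    apply: cvg_eqr; last by rewrite -(mulr0 0).
    by under eq_fun do rewrite expr2; exact: cvgM.
  apply: cvg_mul0r; apply: cvg_eqr; last exact: addr0.
  by apply: cvgD; apply: orth => //; exact: (eigenvector_muli J_pos KP wE).
have D_cvg : ip (u_ m) (u_ m) - \sum_(i < k) transform_sqr (N m) (u_ m) (zeta i.+1)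
    @[m --> \oo] --> ip u u.
  apply: (@cvg_eqr _ _ (ip u u - \sum_(i < k) 0)); last by rewrite big1// subr0.
  by apply: cvgB; [exact: (cvg_ip ip_inner uu uu)|exact: cvg_bigsum].
have u_gt0 := ip_gt0 ip_inner u0.
apply/cvgrPdist_lt => e e0.
(* The limit is positive, so [m] can be fixed here with a positive value, before [n] varies. *)
have : (zeta k.+1 + e) * (ip (u_ m) (u_ m) -
    \sum_(i < k) transform_sqr (N m) (u_ m) (zeta i.+1)) - ip (f_ m) (u_ m)
    @[m --> \oo] --> e * ip u u.
  apply: (@cvg_eqr _ _ ((zeta k.+1 + e) * ip u u - zeta k.+1 * ip u u)); last by ring.
  apply: cvgB; first exact: cvgMl_tmp.
  by rewrite -(ipZl (zeta k.+1) u u).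
move=> /(cvgr_gt _)/(_ _ (mulr_gt0 e0 u_gt0))[m _ /(_ m (leqnn m)) /= m_gt].
(* With [m] fixed, the transforms are continuous in the node, and the induction hypothesis replaces
   each [zeta i.+1] by [x i.+1 n]. *)
have : (zeta k.+1 + e) * (ip (u_ m) (u_ m) -
    \sum_(i < k) transform_sqr (N m) (u_ m) (x i.+1 n))
    @[n --> \oo] --> (zeta k.+1 + e) * (ip (u_ m) (u_ m) -
    \sum_(i < k) transform_sqr (N m) (u_ m) (zeta i.+1)).
  apply: cvgMl_tmp; apply: cvgB; first exact: cvg_cst.
  apply: cvg_bigsum => i _; have xi := IH i (ltn_ord i).
  have comb (c : nat -> R) : (\sum_(l < N m) c l * P l (x i.+1 n)) ^+ 2
      @[n --> \oo] --> (\sum_(l < N m) c l * P l (zeta i.+1)) ^+ 2.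
    have cs : \sum_(l < N m) c l * P l (x i.+1 n) @[n --> \oo] -->
        \sum_(l < N m) c l * P l (zeta i.+1).
      apply: cvg_bigsum => l _; apply: cvgMl_tmp.
      by apply: (cvg_comp _ _ xi); exact: orthonormal_poly_continuous.
    by rewrite expr2; under eq_fun do rewrite expr2; exact: cvgM.
  by apply: cvgD; [exact: (comb (fun l => Re (u_ m l)))|
    exact: (comb (fun l => Im (u_ m l)))].
move=> /(cvgr_gt _)/(_ (ip (f_ m) (u_ m))).
rewrite -subr_gt0 => /(_ m_gt)[M _ MP].
exists (maxn M (maxn (N m) k.+1)) => // n /=; rewrite !geq_max => /and3P[Mn Nn kn].
have := MP n Mn => /=; have := zeros_transform_bound (uf m) (NP m) Nn kn.
set D := ip _ _ - _; set E := ip (f_ m) (u_ m) => xD zD.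
have n0 : (1 <= n)%N := leq_ltn_trans (leq0n k) kn.
have zx : zeta k.+1 < x k.+1 n by exact: zeta_lt_zeros.
have E0 : 0 <= E := jacobi_ge0 J_pos (jacobi_finite_jacobi (uf m)).
have z0 := zeta_pos (ltn0Sn k).
(* [D] is positive because [(zeta k.+1 + e) D > E >= 0], so it can be cancelled from
   [x k.+1 n * D <= E < (zeta k.+1 + e) D]. *)
have D0 : 0 < D by rewrite -(pmulr_rgt0 _ (addr_gt0 z0 e0)) (le_lt_trans E0).
rewrite ltr0_norm ?subr_lt0// opprB ltrBlDl -(ltr_pM2r D0).
exact: le_lt_trans zD.
Qed.

End eigenvalue_comparison.

Unset Implicit Arguments.

Theorem theorem4p1 (R : realType) (a b : nat -> R)
    (a_gt0 : forall n : nat, 0 < a n)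
    (J_pos : positive_operator (jacobi a b))
    (JF_inv_compact : compact_operator (op_inverse (friedrichs (jacobi a b))))
    (zeta : nat -> R)
    (zeta_gt0 : 0 < zeta 1%N)
    (zeta_incr : forall j : nat, (1 <= j)%N -> zeta j < zeta j.+1)
    (zeta_spectrum : spectrum (friedrichs (jacobi a b)) =
       [set (zeta j)%:C | j in [set j : nat | (1 <= j)%N]])
    (x : nat -> nat -> R)
    (x_incr : forall n i j : nat,
       (1 <= i)%N -> (i < j)%N -> (j <= n)%N -> x i n < x j n)
    (x_zeros : forall n : nat, (1 <= n)%N ->
       [set t : R | root (ortho_poly a b n) t] =
       [set x j n | j in [set j : nat | (1 <= j <= n)%N]]) :
  (forall n j : nat, (1 <= n)%N -> (1 <= j <= n)%N -> zeta j < x j n) /\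
  (forall j : nat, (1 <= j)%N -> x j n @[n --> \oo] --> zeta j).
Proof.
have [K KP] := exists_friedrichs_solution JF_inv_compact.
split=> [n j n1 jn|j j1].
  exact: (zeta_lt_zeros a_gt0 J_pos JF_inv_compact zeta_gt0 zeta_incr
    zeta_spectrum x_incr x_zeros KP n1 jn).
exact: (zeros_cvg a_gt0 J_pos JF_inv_compact zeta_gt0 zeta_incr
  zeta_spectrum x_incr x_zeros KP j1).
Qed.
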